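(* Let $k\ge 0$ and let $S$ be a $k$-stacked polytopal sphere of dimension $d\ge 2k$, with vertex set $V$. Then there is a unique $k$-stacked $(d+1)$-ball $\overline{S}$ such that $S=\partial\overline{S}$. Further, $\overline{S}$ is given by the formula $$\overline{S}=\left\{\alpha\subseteq V \;:\; \text{every subset of }\alpha\text{ of size}\le k+1\text{ is a face of }S\right\}.$$
   Context: All simplicial complexes are finite and abstract, and the empty set is a face of every complex. A triangulated sphere/ball is a simplicial complex whose geometric carrier is homeomorphic to a sphere/ball. The boundary $\partial B$ of a triangulated $(d+1)$-ball $B$ is the pure subcomplex whose facets are the $d$-faces of $B$ lying in exactly one $(d+1)$-face. For $0\le k\le d+1$, a triangulated $(d+1)$-ball $B$ is $k$-stacked if all faces of $B$ of dimension $\le d-k$ lie in $\partial B$. A triangulated $d$-sphere $S$ is $k$-stacked if $S=\partial B$ for some $k$-stacked $(d+1)$-ball $B$. A triangulated sphere is polytopal if it is isomorphic to the boundary complex of a simplicial convex polytope $P$, i.e. to the abstract complex of all vertex subsets $A$ of $P$ such that $\mathrm{conv}(A)$ is a proper face of $P$. *)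

(* Defs.v *)
From HB Require Import structures.
From mathcomp Require Import all_boot all_order all_algebra.
From mathcomp Require Import finmap.
From mathcomp Require Import all_classical all_reals all_analysis.
Import Order.TTheory GRing.Theory Num.Theory.
Import numFieldNormedType.Exports.

Set Implicit Arguments.
Unset Strict Implicit.
Unset Printing Implicit Defensive.

Local Open Scope classical_set_scope.
Local Open Scope ring_scope.

(* A complex is the (classical) set of its faces, which are finite sets of
   vertices taken in a choiceType K.  A face A has dimension #|` A| - 1. *)

Definition simplicial_complex (K : choiceType) (X : set {fset K}) : Prop :=
  [/\ finite_set X, X fset0 &
      forall A B : {fset K}, X B -> (A `<=` B)%fset -> X A].

(* K may contain elements that are not vertices of X. *)
Definition vertices (K : choiceType) (X : set {fset K}) : set K :=
  [set x | X [fset x]%fset].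

(* The geometric carrier in barycentric coordinates.  {ptws K -> R} has the
   product topology, which induces the usual one on the carrier of a finite
   complex. *)
Definition carrier (R : realType) (K : choiceType) (X : set {fset K}) :
    set {ptws K -> R} :=
  [set w | exists A : {fset K},
    [/\ X A, forall x, 0 <= w x, forall x, x \notin A -> w x = 0 &
        \sum_(x <- A) w x = 1]].

Definition homeomorphic (X Y : topologicalType) (A : set X) (B : set Y) :
    Prop :=
  exists (f : X -> Y) (g : Y -> X),
    [/\ {within A, continuous f} /\ {within B, continuous g},
        forall x, A x -> B (f x), forall y, B y -> A (g y),
        forall x, A x -> g (f x) = x & forall y, B y -> f (g y) = y].

Definition dot (R : realType) (n : nat) (x y : 'rV[R]_n) : R :=
  \sum_(i < n) x 0 i * y 0 i.

Definition euclidean_sphere (R : realType) (d : nat) : set 'rV[R]_d.+1 :=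
  [set x | dot x x = 1].

Definition euclidean_ball (R : realType) (n : nat) : set 'rV[R]_n :=
  [set x | dot x x <= 1].

Definition triangulated_sphere (R : realType) (K : choiceType) (d : nat)
    (S : set {fset K}) : Prop :=
  simplicial_complex S /\
  homeomorphic (@carrier R K S) (@euclidean_sphere R d).

Definition triangulated_ball (R : realType) (K : choiceType) (n : nat)
    (B : set {fset K}) : Prop :=
  simplicial_complex B /\
  homeomorphic (@carrier R K B) (@euclidean_ball R n).

(* The boundary of a (d+1)-ball B: generated by the d-faces of B lying in
   exactly one (d+1)-face of B. *)
Definition ball_boundary (K : choiceType) (d : nat) (B : set {fset K}) :
    set {fset K} :=
  [set A | exists F : {fset K},
    [/\ B F, #|` F| = d.+1,
        exists! G : {fset K}, [/\ B G, #|` G| = d.+2 & (F `<=` G)%fset] &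
        (A `<=` F)%fset]].

(* B is a k-stacked (d+1)-ball, for 0 <= k <= d+1.  The inequality
   #|` A| + k <= d + 1 says that dim A <= d - k, as integers. *)
Definition stacked_ball (R : realType) (K : choiceType) (k d : nat)
    (B : set {fset K}) : Prop :=
  [/\ (k <= d.+1)%N, triangulated_ball R d.+1 B &
      forall A : {fset K}, B A -> (#|` A| + k <= d.+1)%N ->
        ball_boundary d B A].

Definition stacked_sphere (R : realType) (K : choiceType) (k d : nat)
    (S : set {fset K}) : Prop :=
  triangulated_sphere R d S /\
  exists B : set {fset K}, stacked_ball R k d B /\ S = ball_boundary d B.

Definition conv_hull (R : realType) (n : nat) (A : {fset 'rV[R]_n}) :
    set 'rV[R]_n :=
  [set p | exists w : 'rV[R]_n -> R,
    [/\ forall v, v \in A -> 0 <= w v, \sum_(v <- A) w v = 1 &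
        p = \sum_(v <- A) w v *: v]].

Definition affinely_independent (R : realType) (n : nat)
    (A : {fset 'rV[R]_n}) : Prop :=
  forall w : 'rV[R]_n -> R,
    \sum_(v <- A) w v = 0 -> \sum_(v <- A) w v *: v = 0 ->
    forall v, v \in A -> w v = 0.

Definition polytope (R : realType) (n : nat) (P : set 'rV[R]_n) : Prop :=
  exists A : {fset 'rV[R]_n}, P = conv_hull A.

(* Faces are cut out by valid inequalities c.x <= b.  The vector c may be 0,
   so that the empty set and P itself are faces. *)
Definition polytope_face (R : realType) (n : nat) (P F : set 'rV[R]_n) :
    Prop :=
  exists (c : 'rV[R]_n) (b : R),
    (forall x, P x -> dot c x <= b) /\ F = [set x | P x /\ dot c x = b].

Definition proper_face (R : realType) (n : nat) (P F : set 'rV[R]_n) : Prop :=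
  polytope_face P F /\ F <> P.

Definition polytope_vertex (R : realType) (n : nat) (P : set 'rV[R]_n)
    (v : 'rV[R]_n) : Prop := polytope_face P [set v].

Definition simplicial_polytope (R : realType) (n : nat) (P : set 'rV[R]_n) :
    Prop :=
  polytope P /\
  forall F, proper_face P F ->
    exists A : {fset 'rV[R]_n}, affinely_independent A /\ F = conv_hull A.

Definition boundary_complex (R : realType) (n : nat) (P : set 'rV[R]_n) :
    set {fset 'rV[R]_n} :=
  [set A | (forall v, v \in A -> polytope_vertex P v) /\
           proper_face P (conv_hull A)].

(* S is isomorphic to a boundary complex: an f that is injective on the
   vertices of S sends the faces of S exactly onto the faces of the target. *)
Definition polytopal (R : realType) (K : choiceType) (S : set {fset K}) :
    Prop :=
  exists (n : nat) (P : set 'rV[R]_n) (f : K -> 'rV[R]_n),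
    [/\ simplicial_polytope P,
        forall x y, vertices S x -> vertices S y -> f x = f y -> x = y &
        boundary_complex P =
          [set [fset f x | x in A]%fset | A in S]].

Definition clique_extension (K : choiceType) (k : nat) (S : set {fset K}) :
    set {fset K} :=
  [set A | (forall x, x \in A -> vertices S x) /\
           forall B : {fset K}, (B `<=` A)%fset -> (#|` B| <= k.+1)%N -> S B].

(* Main.v *)
Require Import Defs.
From mathcomp Require Import all_boot all_order all_algebra.
From mathcomp Require Import fingroup perm.
From mathcomp Require Import finmap.
From mathcomp Require Import all_classical all_reals all_analysis.
From mathcomp Require Import lra zify.
Import Order.TTheory GRing.Theory Num.Theory.
Import numFieldNormedType.Exports.
Set Implicit Arguments.
Unset Strict Implicit.
Unset Printing Implicit Defensive.
Local Open Scope classical_set_scope.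
Local Open Scope ring_scope.

(* Let B be a k-stacked ball with boundary S and let A be a set of vertices all of whose subsets of size at
   most k + 1 are faces of S. Map B to the polytope P, linearly on simplices. This map covers P: if it missed
   an interior point p, projecting radially from p would give a retraction of |B| onto |S|, and following it by the
   antipodal map of the sphere would give a self-map of the ball without fixed points, against Brouwer. So if
   A is not in B, the barycentre of A lies in the image of some F in B. This gives an affine dependency
   between A and F, hence one with at most d + 3 vertices (P has dimension d + 1), conformal to it. Neither
   its positive part (inside A) nor its negative part (inside F) is a face of S, so they have at least k + 2
   and d - k + 2 vertices: too many. *)

(** * Cup products of coboundaries modulo 2 *)

(** The hypothesis d >= 2k serves the inclusion of B in the clique complex: a subset of a face of B
    with at most k + 1 elements has dimension at most k <= d - k, so stackedness puts it in S. For
    the converse a single preimage of the barycentre supplies F, which is why only surjectivity of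
    the map to P is at stake. The polytope may sit in a space of dimension greater than d + 1.
    Rotating a supporting hyperplane about a facet shows that the homogenized vertices span at most
    d + 2 dimensions, whence the bound d + 3 on the dependency. The radial projection is not written
    as a formula: the exit point of a ray is the unique solution of an equation over a compact set,
    and this alone makes it continuous. Brouwer's theorem is derived from Kuhn's lemma on a
    triangulated cube, where a degree modulo 2, an integral of cup products, takes the place of
    counting simplices. *)

Section CupProducts.
Implicit Types f : nat -> nat -> 'F_2.

Lemma addFF (x : 'F_2) : x + x = 0.
Proof. by rewrite -mulr2n mulr2n; case: x => [[|[]]] //= i; apply/val_inj. Qed.

Lemma addFK (x y : 'F_2) : x + (x + y) = y.
Proof. by rewrite addrA addFF add0r. Qed.

Lemma bumpS m i : bump m.+1 i.+1 = (bump m i).+1.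
Proof. by rewrite /bump ltnS addnS. Qed.

(** The Alexander-Whitney cup product of the coboundaries of the first n cochains, on the simplex
    with vertices [b 0], ..., [b n]; modulo 2 there are no signs. With [b := bump m] it is taken on
    the facet opposite to vertex m. *)
Definition cup n f (b : nat -> nat) : 'F_2 :=
  \prod_(i < n) (f i (b i) + f i (b i.+1)).

(** The tail is a cocycle by induction, which leaves the first factor summed over the three edges of
    the triangle 0, 1, 2, and this sum is 0. So a product of cocycles is a cocycle. *)
Lemma cup_closed n f : \sum_(m < n.+2) cup n f (bump m) = 0.
Proof.
elim: n f => [|n IH] f.
  rewrite /cup !big_ord_recl !big_ord0 addr0; exact: addFF.
pose g i m := f i.+1 m.+1.
have := IH g.
have E0 : cup n.+1 f (bump 0) = (f 0%N 1%N + f 0%N 2%N) * cup n g (bump 0).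
  by rewrite /cup big_ord_recl.
have ES m : cup n.+1 f (bump m.+1) =
    (f 0%N 0%N + f 0%N (bump m 0).+1) * cup n g (bump m).
  rewrite /cup big_ord_recl /= bumpS; congr (_ * _).
  by apply: eq_bigr => i _; rewrite /= !bumpS.
rewrite big_ord_recl => /eqP.
rewrite addr_eq0 => /eqP H.
rewrite big_ord_recl E0 big_ord_recl.
rewrite [cup _ _ (bump (lift ord0 ord0))](ES 0%N).
rewrite (eq_bigr (fun m : 'I_n.+1 => (f 0%N 0%N + f 0%N 1%N) * cup n g (bump m.+1))); last first.
  by move=> m _; rewrite [LHS](ES m.+1).
rewrite -mulr_sumr.
have -> : \sum_(m < n.+1) cup n g (bump m.+1) = cup n g (bump 0).
  by rewrite H oppr_pchar2 // ; apply: pchar_Fp.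
rewrite -!mulrDl.
have F2E (a b c : 'F_2) : a + b + (c + b + (c + a)) = 0.
  by rewrite (addrACA c) addFF add0r (addrC b) addFF.
by rewrite [X in X * _]F2E mul0r.
Qed.

(* The cup product of coboundaries, with the j-th coboundary replaced by the 0-cochain f j. *)
Definition cupmid n j f (b : nat -> nat) : 'F_2 :=
  \prod_(i < n) (if (i < j)%N then f i (b i) + f i (b i.+1)
    else if i == j :> nat then f i (b i) else f i (b i.-1) + f i (b i)).

(** Leibniz rule: all factors but [f j] are cocycles, so the coboundary acts on [f j] alone. The
    induction on j strips the first factor. *)
Lemma cupmid_coboundary n j f : (j <= n)%N ->
  \sum_(m < n.+2) cupmid n.+1 j f (bump m) = cup n.+1 f id.
Proof.
elim: j n f => [|j IH] n f jn.
  have E (b : nat -> nat) : cupmid n.+1 0 f b = f 0%N (b 0%N) * cup n (fun i => f i.+1) b.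
    by rewrite /cupmid big_ord_recl.
  rewrite big_ord_recl E.
  rewrite (eq_bigr (fun m : 'I_n.+1 => f 0%N 0%N * cup n (fun i => f i.+1) (bump m.+1))); last first.
    by move=> m _; rewrite E.
  rewrite -mulr_sumr.
  have := cup_closed n (fun i => f i.+1); rewrite big_ord_recl => /eqP.
  rewrite addr_eq0 => /eqP H.
  have -> : \sum_(m < n.+1) cup n (fun i => f i.+1) (bump m.+1) = cup n (fun i => f i.+1) (bump 0).
    by rewrite H oppr_pchar2 //; apply: pchar_Fp.
  by rewrite -mulrDl addrC /cup [in RHS]big_ord_recl.
case: n jn => // n jn.
pose g i m := f i.+1 m.+1.
have := IH n g jn.
have E0 : cupmid n.+2 j.+1 f (bump 0) = (f 0%N 1%N + f 0%N 2%N) * cupmid n.+1 j g (bump 0).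
  rewrite /cupmid big_ord_recl; congr (_ * _).
  apply: eq_bigr => -[i hi] _ /=; rewrite /bump /= !add1n ltnS eqSS.
  case: ltnP => // ji; case: eqP => // /eqP nij.
  by case: i hi ji nij => [|i] hi; rewrite ?leqn0 // => /eqP ->; rewrite eqxx.
have ES m : cupmid n.+2 j.+1 f (bump m.+1) =
    (f 0%N 0%N + f 0%N (bump m 0).+1) * cupmid n.+1 j g (bump m).
  rewrite /cupmid big_ord_recl /= bumpS; congr (_ * _).
  apply: eq_bigr => -[i hi] _ /=; rewrite !bumpS ltnS eqSS.
  case: ltnP => // ji; case: eqP => // /eqP nij.
  case: i hi ji nij => [|i] hi; last by rewrite !bumpS.
  by rewrite leqn0 => /eqP ->; rewrite eqxx.
move=> H.
rewrite big_ord_recl E0.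
(* Only for m = 0 is the first edge 02 instead of 01; the difference is the edge 12, and this
   correction cancels the term of facet 0. *)
rewrite (eq_bigr (fun m : 'I_n.+2 => (f 0%N 0%N + f 0%N 1%N) * cupmid n.+1 j g (bump m) +
  (m == ord0)%:R * ((f 0%N 1%N + f 0%N 2%N) * cupmid n.+1 j g (bump 0)))); last first.
  move=> [[|m] hm] _; rewrite /= ES /=; last by rewrite /bump /= mul0r addr0.
  rewrite mul1r -mulrDl; congr (_ * _).
  by rewrite -addrA addFK.
rewrite big_split /= -mulr_sumr H [X in _ + (_ + X)]big_ord_recl /= mul1r big1 ?addr0; last first.
  by move=> i _; rewrite mul0r.
rewrite addrC -addrA addFF addr0 /cup [in RHS]big_ord_recl; congr (_ * _).
Qed.

End CupProducts.

(** * Kuhn's lemma *)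

Section Kuhn.
Variables n p : nat.
Notation pt := {ffun 'I_n.+1 -> nat}.
Notation cell := ({ffun 'I_n.+1 -> 'I_p.+1} * 'S_n.+1)%type.

(* The cell (x, t) is the simplex with vertices x = v_0, ..., v_(n+1) = x + (1, ..., 1), where
   v_(m+1) is obtained from v_m by incrementing the coordinate of position m in t. *)
Definition kuhn_vertex (c : cell) m : pt :=
  [ffun i => (c.1 i + (c.2 i < m))%N].

(** Multiplication by the transposition matches even with odd permutations, so equal terms cancel in
    pairs. *)
Lemma sum_swap_zero (g : 'S_n.+1 -> 'F_2) (a b : 'I_n.+1) :
  a != b -> (forall t, g (t * tperm a b)%g = g t) -> \sum_t g t = 0.
Proof.
move=> ab gE; rewrite (bigID (@odd_perm _)) /=.
rewrite (reindex_inj (mulIg (tperm a b))) /=.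
rewrite (eq_bigl (fun t : 'S_n.+1 => ~~ t)); last first.
  by move=> t; rewrite odd_permM odd_tperm ab addbT.
rewrite (eq_bigr g) //; exact: addFF.
Qed.

(* The cell across the facet of c opposite to its vertex 0, the grid being taken cyclically. *)
Definition next_cell (c : cell) : cell :=
  ([ffun i => if c.2 i == ord0 then ordS (c.1 i) else c.1 i],
   perm (inj_comp (bij_inj (ord_pred_bij n.+1)) (@perm_inj _ c.2))).

Lemma next_cell_inj : injective next_cell.
Proof.
move=> [x s] [y t] [/ffunP xy st].
have {}st : s = t.
  apply/permP => i; have := congr1 (fun u : 'S__ => u i) st.
  by rewrite !permE /= => /(bij_inj (ord_pred_bij _)).
rewrite -st in xy *; congr (_, _); apply/ffunP => i.
have := xy i; rewrite !ffunE /=.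
by case: ifP => // _ /(bij_inj (ordS_bij _)).
Qed.

(* Facets opposite to inner vertices are shared by two cells with the same x; the two other facets of a
   cell are shared with its neighbours, or lie on the boundary of the grid, where w vanishes. *)
Lemma kuhn_stokes (w : (nat -> pt) -> 'F_2) :
  (forall u u', (forall m, (m <= n)%N -> u m = u' m) -> w u = w u') ->
  (forall (u : nat -> pt) i, (forall m, (m <= n)%N -> u m i = 0%N) -> w u = 0) ->
  (forall (u : nat -> pt) i, (forall m, (m <= n)%N -> u m i = p.+1) -> w u = 0) ->
  \sum_(c : cell) \sum_(m < n.+2) w (fun l => kuhn_vertex c (bump m l)) = 0.
Proof.
move=> wext w0 wp; rewrite exchange_big big_ord_recl big_ord_recr /=.
rewrite addrCA big1 ?add0r; last first.
  move=> m _; rewrite -(pair_bigA _ (fun x t => w (fun l => kuhn_vertex (x, t) (bump (bump 0 m) l)))) /=.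
  apply: big1 => x _.
  have mn : (m < n.+1)%N by rewrite ltnS ltnW.
  have ab : Ordinal mn != lift ord0 m.
    by rewrite -val_eqE /= /bump /= add1n ltn_eqF.
  (* Exchanging the positions m and m + 1 in t moves only the vertex m + 1, which this facet
     omits. *)
  apply: (sum_swap_zero ab) => t; apply: wext => l _; apply/ffunP => i.
  rewrite !ffunE /= permM; congr (_ + nat_of_bool _)%N.
  have mE : bump 0 m = m.+1 by [].
  case: tpermP => [->|->|//] /=; rewrite mE /bump; case: ltngtP => //=; lia.
rewrite [X in _ + X](reindex_inj next_cell_inj) -big_split big1 //= => -[x t] _.
rewrite (_ : w _ = w (fun l => kuhn_vertex (next_cell (x, t)) (bump (bump 0 n) l))) ?addFF //.
(* The direction of the first step of the cell. If [x i0] is p, the facet lies in the side i0 = p +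
   1 of the grid and its cyclic neighbour in the side i0 = 0, and w vanishes on both. *)
pose i0 := (t^-1)%g ord0.
have ti0 : t i0 = ord0 by rewrite permKV.
have bumpn m : (m <= n)%N -> bump (bump 0 n) m = m by rewrite /bump; lia.
have [xi0|xi0] := eqVneq (x i0 : nat) p.
  rewrite (wp _ i0); last by move=> m mn; rewrite ffunE /= ti0 xi0 /bump /=; lia.
  rewrite (w0 _ i0) // => m mn; rewrite bumpn // !ffunE /= permE /= ti0 eqxx /= xi0 modnn.
  by rewrite modn_small ?ltnS // ltnNge mn.
apply: wext => m mn; apply/ffunP => i.
rewrite bumpn // !ffunE /= permE /=.
have [ti|ti] := eqVneq (t i) ord0.
  have -> : i = i0 by rewrite /i0 -ti permK.
  have xlt : (x i0 < p)%N by rewrite ltn_neqAle xi0 -ltnS ltn_ord.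
  by rewrite ti0 /= /bump !modn_small //; lia.
have : (0 < t i)%N by rewrite lt0n.
have := ltn_ord (t i).
move: (t i : nat) => a an a0.
have -> : ((a + n.+1).-1 %% n.+1 = a.-1)%N.
  by rewrite addnS /= -{1}(prednK a0) addSnnS modnDr modn_small //; lia.
rewrite /bump; lia.
Qed.

Lemma F2_neq0 (a b : bool) : (a%:R + b%:R != 0 :> 'F_2) -> a != b.
Proof. by apply: contra_neq => ->; exact: addFF. Qed.

(* The cup product of the coboundaries of the labels, integrated over the triangulated grid. *)
Definition kuhn_degree (lam : nat -> pt -> 'F_2) :=
  \sum_(c : cell) cup n.+1 (fun j m => lam j (kuhn_vertex c m)) id.

Definition kuhn_labelling (lam : nat -> pt -> bool) :=
  forall (i : 'I_n.+1) (v : pt),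
    (v i = 0%N -> lam i v = false) /\ (v i = p.+1 -> lam i v = true).

(* The two integrands differ by the coboundary of a cochain vanishing on the boundary of the grid. *)
Lemma kuhn_degree_change (lam lam' : nat -> pt -> bool) (j : 'I_n.+1) :
  kuhn_labelling lam -> kuhn_labelling lam' ->
  (forall i, i != j :> nat -> lam i =1 lam' i) ->
  kuhn_degree (fun i v => (lam i v)%:R) = kuhn_degree (fun i v => (lam' i v)%:R).
Proof.
move=> hl hl' ll'.
(* By multilinearity the two degrees differ by that of [mu], whose j-th entry vanishes on both sides
   of the grid in direction j. *)
pose mu i v : 'F_2 := if i == j :> nat then (lam i v)%:R + (lam' i v)%:R else (lam i v)%:R.
have mu0 (i : 'I_n.+1) (v : pt) : v i = 0%N -> mu i v = 0.
  move=> vi; have [h _] := hl i v; have [h' _] := hl' i v.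
  by rewrite /mu h // h' // addr0 if_same.
have mup (i : 'I_n.+1) (v : pt) : v i = p.+1 -> mu i v = (i != j :> nat)%:R.
  move=> vi; have [_ h] := hl i v; have [_ h'] := hl' i v.
  by rewrite /mu h // h' // addFF; case: eqP.
have -> : kuhn_degree (fun i v => (lam i v)%:R) =
   kuhn_degree (fun i v => (lam' i v)%:R) + kuhn_degree mu.
  rewrite -big_split; apply: eq_bigr => c _ /=.
  rewrite /cup (bigD1 j) //= [X in _ = X + _](bigD1 j) //= [X in _ = _ + X](bigD1 j) //=.
  have E (f : nat -> pt -> 'F_2) : (forall i, i != j :> nat -> f i =1 fun v => (lam i v)%:R) ->
    \prod_(i < n.+1 | i != j) (f i (kuhn_vertex c i) + f i (kuhn_vertex c i.+1)) =
    \prod_(i < n.+1 | i != j) ((lam i (kuhn_vertex c i))%:R + (lam i (kuhn_vertex c i.+1))%:R).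
    by move=> fE; apply: eq_bigr => i ij; rewrite !fE.
  rewrite [X in _ = _ * X + _](E (fun i v => (lam' i v)%:R)); last by move=> i ij v; rewrite ll'.
  rewrite (E mu); last by move=> i ij v; rewrite /mu (negbTE ij).
  rewrite -mulrDl; congr (_ * _); rewrite /mu eqxx.
  set a := (lam _ _)%:R; set b := (lam _ _)%:R; set c' := (lam' _ _)%:R; set d := (lam' _ _)%:R.
  by rewrite (addrACA a) (addrC (a + b)) addFK.
suff -> : kuhn_degree mu = 0 by rewrite addr0.
pose w (u : nat -> pt) := cupmid n.+1 j (fun i m => mu i (u m)) id.
(* On a side in a direction i other than j, [mu i] is constant, so its coboundary factor vanishes;
   on the sides in direction j the factor [mu j] does. *)
have const0 (u : nat -> pt) (i : 'I_n.+1) : i != j ->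
    (forall m m', (m <= n)%N -> (m' <= n)%N -> mu i (u m) = mu i (u m')) -> w u = 0.
  move=> ij um; have ijn : (i == j :> nat) = false by apply/negbTE.
  rewrite /w /cupmid (bigD1 i) //= ijn.
  have in1 := ltn_ord i; have jn := ltn_ord j.
  case: ltnP => lij; [rewrite (um i i.+1)|rewrite (um i.-1 i)]; rewrite ?addFF ?mul0r //; lia.
rewrite -[RHS](@kuhn_stokes w).
- apply: eq_bigr => c _; rewrite -(cupmid_coboundary _ (ltn_ord j : j <= n)%N).
  by apply: eq_bigr => m _.
- move=> u u' uu'; apply: eq_bigr => i _; have in1 := ltn_ord i; have jn := ltn_ord j.
  case: ltnP => ij; first by rewrite !uu' //; lia.
  by rewrite !uu' //; lia.
- move=> u i ui; have [ij|ij] := eqVneq i j.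
    rewrite /w /cupmid (bigD1 i) //= ij ltnn eqxx mu0 ?mul0r // -ij ui //.
    by rewrite -ltnS.
  by apply: (const0 _ i ij) => m m' mn mn'; rewrite !mu0 // ui.
- move=> u i ui; have [ij|ij] := eqVneq i j.
    rewrite /w /cupmid (bigD1 i) //= ij ltnn eqxx mup ?eqxx ?mul0r // -ij ui //.
    by rewrite -ltnS.
  by apply: (const0 _ i ij) => m m' mn mn'; rewrite !mup // ui.
Qed.

(** The labels are replaced one at a time by those of [kap], which keeps the degree. For [kap] only
    the cell at the origin with the identity permutation contributes, so the degree is 1 and some
    cell has a nonzero product. *)
Theorem kuhn_cell (lam : nat -> pt -> bool) : kuhn_labelling lam ->
  exists c : cell, forall j : 'I_n.+1,
    lam j (kuhn_vertex c j) != lam j (kuhn_vertex c j.+1).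
Proof.
move=> hl.
pose kap i (v : pt) := (0 < v (inord i))%N.
have hk : kuhn_labelling kap by move=> i v; rewrite /kap inord_val; split=> ->.
pose hyb j i v := if (i < j)%N then kap i v else lam i v.
have hh j : kuhn_labelling (hyb j).
  by move=> i v; rewrite /hyb; case: ifP => _; [exact: hk|exact: hl].
have degE j : (j <= n.+1)%N -> kuhn_degree (fun i v => (lam i v)%:R) =
    kuhn_degree (fun i v => (hyb j i v)%:R).
  elim: j => [|j IH] // jn; rewrite IH; last exact: ltnW.
  apply: (@kuhn_degree_change _ _ (Ordinal jn)) => // i ij v.
  have {ij} ij : (i == j) = false by apply/negbTE.
  by rewrite /hyb [(i < j.+1)%N]ltnS [(i <= j)%N]leq_eqVlt ij.
have deg1 : kuhn_degree (fun i v => (lam i v)%:R) = 1.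
  rewrite (degE n.+1) //.
  rewrite /kuhn_degree (bigD1 ([ffun=> ord0], 1%g)) //= big1 ?addr0.
    rewrite /cup big1 // => i _; rewrite /hyb ltn_ord /kap inord_val !ffunE perm1 /=.
    by rewrite ltnn ltnSn /= add0r.
  move=> [x t] /eqP xt; apply/eqP; apply: contra_notT xt => /prodf_neq0 H.
  have {}H i : x i = ord0 /\ t i = i.
    have := F2_neq0 (H i isT); rewrite /hyb ltn_ord /kap inord_val !ffunE /=.
    by move=> h; split; apply/val_inj => /=; lia.
  by congr (_, _); [apply/ffunP|apply/permP] => i; rewrite ?ffunE ?perm1; case: (H i).
have [c cP] : exists c : cell, cup n.+1 (fun j m => (lam j (kuhn_vertex c m))%:R) id != 0.
  apply/existsP; apply: contraT => /existsPn H.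
  by move: deg1; rewrite /kuhn_degree big1 // => c _; apply/eqP; have := H c; rewrite negbK.
by exists c => j; have /prodf_neq0 /(_ j isT) := cP; exact: F2_neq0.
Qed.

End Kuhn.

(** * Brouwer's fixed point theorem *)

Section BrouwerCube.
Variables (R : realType) (n : nat) (g : 'rV[R]_n.+1 -> 'rV[R]_n.+1).
Hypothesis cg : continuous g.
Hypothesis g1 : forall x i, `|g x 0 i| <= 1.

Let D i (y : 'rV[R]_n.+1) : R := g y 0 i - y 0 i.

Let D_continuous i : continuous (D i).
Proof.
move=> x; apply: (@continuousB _ _ _ (fun y => g y 0 i) (fun y => y 0 i)).
  by apply: (@continuous_comp _ _ _ g (fun v => v 0 i)); [exact: cg|exact: coord_continuous].
exact: coord_continuous.
Qed.

Lemma ball_same_sign x i : D i x != 0 -> exists2 r : R, 0 < r &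
  forall y z, ball x r y -> ball x r z -> 0 < D i y * D i z.
Proof.
move=> Dx; have : \forall y \near x, 0 < D i x * D i y.
  have Dc : {for x, continuous (fun y => D i x * D i y)}.
    by apply: continuousM; [exact: cst_continuous|exact: D_continuous].
  by apply: (cvgr_gt _ Dc); rewrite -expr2 exprn_even_gt0.
move=> /nbhs_ballP[r r0 H]; exists r => // y z /H Hy /H Hz.
have : 0 < (D i x * D i y) * (D i x * D i z) by apply: mulr_gt0.
by rewrite mulrACA -expr2 pmulr_rgt0 // exprn_even_gt0.
Qed.

Let grid p (v : {ffun 'I_n.+1 -> nat}) : 'rV[R]_n.+1 :=
  \row_i (2 * (v i)%:R / p.+1%:R - 1).

Let lam p i (v : {ffun 'I_n.+1 -> nat}) : bool :=
  (v (inord i) == p.+1) || (0 < v (inord i))%N && (D (inord i) (grid p v) < 0).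

Let lam_labelling p : kuhn_labelling p (lam p).
Proof. by move=> i v; rewrite /lam inord_val; split=> ->; rewrite ?eqxx. Qed.

(** The labels imposed on the sides of the grid agree with the weak sign of the displacement,
    because g takes values in the cube and so cannot push a side outwards. *)
Lemma gridP p (v : {ffun 'I_n.+1 -> nat}) (i : 'I_n.+1) :
  (v i <= p.+1)%N -> (lam p i v -> D i (grid p v) <= 0) /\
  (~~ lam p i v -> 0 <= D i (grid p v)).
Proof.
move=> vp; rewrite /lam inord_val /D; have := g1 (grid p v) i.
rewrite ler_norml !mxE => /andP[gl gu]; split.
  move=> /orP[/eqP vi|/andP[_ /ltW //]].
  by rewrite vi mulfK ?pnatr_eq0 //; lra.
rewrite negb_or negb_and -leqNgt -leNgt leqn0 => /andP[_] /orP[/eqP v0|//].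
by rewrite v0 mulr0 mul0r; lra.
Qed.

(** Without a fixed point, compactness yields a p such that near each point of the cube, at the
    scale of a cell, some [D i] keeps a strict sign. But along the i-th edge of the cell from Kuhn's
    lemma, [D i] weakly changes sign. *)
Theorem brouwer_cube : exists x, g x = x.
Proof.
apply: contrapT => nofix.
pose C := [set v : 'rV[R]_n.+1 | forall i, `[-1, 1]%classic (v ord0 i)].
have cC : compact C.
  by apply: (@rV_compact R _ (fun=> `[-1, 1]%classic)) => i; exact: segment_compact.
(* Cells have side 2 / (p + 1), so an open ball of radius 3 / (p + 1) about one vertex of a cell
   contains all the others. *)
pose P (p : nat) (x : 'rV[R]_n.+1) := exists i,
  forall y z, ball x (3 * p.+1%:R^-1) y -> ball x (3 * p.+1%:R^-1) z -> 0 < D i y * D i z.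
have : \forall p \near \oo, C `<=` P p.
  have /compact_near_coveringP cov := cC.
  apply: (cov _ _ P) => x _.
  have [i Di] : exists i, D i x != 0.
    apply: contrapT => H; apply: nofix; exists x; apply/rowP => i.
    by apply/eqP; rewrite -subr_eq0; apply: contrapT => Di; apply: H; exists i; apply/negP.
  have [r r0 rP] := ball_same_sign Di.
  have r2 : 0 < r / 2 by lra.
  have r6 : 0 < r / 6 by lra.
  near=> x' p; exists i => y z xy xz.
  have pr : 3 * (p.+1%:R)^-1 <= r / 2.
    suff : p.+1%:R^-1 < r / 6 by move: (_^-1) => q; lra.
    by near: p; exact: (near_infty_natSinv_lt (PosNum r6)).
  have x'x : ball x (r / 2) x' by near: x'; exact: nbhsx_ballx.
  by apply: rP; rewrite (splitr r); apply: (ball_triangle x'x); apply: le_ball pr _ _.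
case=> p _ /(_ _ (leqnn p)) CP.
have [c cP] := kuhn_cell (lam_labelling p).
have vle m i : (kuhn_vertex c m i <= p.+1)%N.
  by rewrite ffunE; have := ltn_ord (c.1 i); case: (_ < m)%N => /=; lia.
have p0 : 0 < p.+1%:R :> R by rewrite ltr0n.
pose x := grid p (kuhn_vertex c 0).
have Cx : C x.
  move=> i /=; rewrite in_itv /= !mxE.
  have vp : (kuhn_vertex c 0 i)%:R / p.+1%:R <= 1 :> R.
    by rewrite ler_pdivrMr // mul1r ler_nat.
  have v0 : 0 <= (kuhn_vertex c 0 i)%:R / p.+1%:R :> R by rewrite divr_ge0.
  by rewrite -mulrA; move: (_ / _) vp v0 => t vp v0; apply/andP; split; lra.
have xb m : ball x (3 * p.+1%:R^-1) (grid p (kuhn_vertex c m)).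
  split=> [|a i]; first by rewrite divr_gt0.
  rewrite (ord1 a) /ball /= !mxE !ffunE !natrD ltn0 addr0.
  set t : R := (c.1 i)%:R; rewrite opprB addrA subrK -mulrBl -mulrBr normrM.
  rewrite [X in _ * X]gtr0_norm ?invr_gt0 // ltr_pM2r ?invr_gt0 //.
  rewrite (_ : t - _ = - (c.2 i < m)%:R); last by lra.
  by rewrite normrM normrN !normr_nat; case: (_ < m)%N => /=; lra.
have [i iP] := CP _ Cx.
have := iP _ _ (xb i) (xb i.+1).
have [a1 a2] := gridP (vle i i); have [b1 b2] := gridP (vle i.+1 i).
rewrite ltNge => /negP[]; have := cP i.
case: (lam p i _) in a1 a2 *; case: (lam p i _) in b1 b2 * => // _.
  by rewrite mulr_le0_ge0 ?a1 ?b2.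
by rewrite mulr_ge0_le0 ?a2 ?b1.
Unshelve. all: by end_near.
Qed.

End BrouwerCube.

Lemma within_continuous_comp_on (X Y Z : topologicalType) (A : set X) (B : set Y)
    (f : X -> Y) (g : Y -> Z) :
  {within A, continuous f} -> {within B, continuous g} ->
  (forall x, A x -> B (f x)) -> {within A, continuous (g \o f)}.
Proof.
move=> /subspace_continuousP cf /subspace_continuousP cg AB.
apply/subspace_continuousP => x Ax W /(cg _ (AB _ Ax)) WB.
have := cf _ Ax _ WB; rewrite /nbhs /= /within /=.
by apply: filterS => y yW Ay; apply: yW => //; exact: AB.
Qed.

Section BrouwerBall.
Variable R : realType.

Lemma continuous_bigsum (T : topologicalType) (V : normedModType R)
    (I : Type) (s : seq I) (f : I -> T -> V) :
  (forall i, continuous (f i)) -> continuous (fun x => \sum_(i <- s) f i x).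
Proof.
move=> cf; elim: s => [|i s IH] x.
  rewrite (_ : (fun _ => _) = fun=> 0); first exact: cst_continuous.
  by apply/funext => y; rewrite big_nil.
rewrite (_ : (fun _ => _) = fun y => f i y + \sum_(j <- s) f j y).
  by apply: (@continuousD _ _ _ (f i) (fun y => \sum_(j <- s) f j y)); [exact: cf|exact: IH].
by apply/funext => y; rewrite big_cons.
Qed.

Lemma dot_continuous n : continuous (fun x : 'rV[R]_n => dot x x).
Proof.
apply: (@continuous_bigsum _ R^o) => i x.
by apply: (@continuousM _ _ (fun x : 'rV[R]_n => x 0 i) (fun x => x 0 i)); exact: coord_continuous.
Qed.

Lemma dotxx_ge0 n (x : 'rV[R]_n) : 0 <= dot x x.
Proof. by apply: sumr_ge0 => i _; rewrite -expr2 sqr_ge0. Qed.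

Lemma dotZZ n a (x : 'rV[R]_n) : dot (a *: x) (a *: x) = a ^+ 2 * dot x x.
Proof. by rewrite /dot mulr_sumr; apply: eq_bigr => i _; rewrite !mxE mulrACA. Qed.

Lemma ball_coord n (x : 'rV[R]_n) i : euclidean_ball x -> `|x 0 i| <= 1.
Proof.
rewrite /euclidean_ball /= /dot (bigD1 i) //= => x1.
rewrite -(ler_pXn2r (ltn0Sn 1)) ?nnegrE // expr1n -normrX ger0_norm ?sqr_ge0 // expr2.
apply: le_trans x1; rewrite lerDl; apply: sumr_ge0 => j _.
by rewrite -expr2 sqr_ge0.
Qed.

Definition ball_retract n (x : 'rV[R]_n) : 'rV[R]_n :=
  (Num.max 1 (Num.sqrt (dot x x)))^-1 *: x.

Lemma ball_retract_id n (x : 'rV[R]_n) : euclidean_ball x -> ball_retract x = x.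
Proof.
move=> x1; rewrite /ball_retract max_l ?invr1 ?scale1r //.
by rewrite -sqrtr1 ler_wsqrtr.
Qed.

Lemma ball_retract_in n (x : 'rV[R]_n) : euclidean_ball (ball_retract x).
Proof.
rewrite /euclidean_ball /= /ball_retract dotZZ exprVn.
have m0 : 0 < Num.max 1 (Num.sqrt (dot x x)) by rewrite lt_max ltr01.
rewrite mulrC ler_pdivrMr ?exprn_gt0 // mul1r.
rewrite -[leLHS]sqr_sqrtr ?dotxx_ge0 // ler_pXn2r ?nnegrE ?sqrtr_ge0 ?(ltW m0) //.
by rewrite le_max lexx orbT.
Qed.

Lemma ball_retract_continuous n : continuous (@ball_retract n).
Proof.
move=> x; apply: (@continuousZ _ _ _ (fun x => (Num.max 1 (Num.sqrt (dot x x)))^-1) id) => //.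
apply: continuousV; first by rewrite gt_eqF // lt_max ltr01.
apply: (@continuous_max _ _ (fun=> 1) (fun x : 'rV[R]_n => Num.sqrt (dot x x))).
  exact: cst_continuous.
apply: (@continuous_comp _ _ _ (fun x : 'rV[R]_n => dot x x) Num.sqrt).
  exact: dot_continuous.
exact: sqrt_continuous.
Qed.

(** Precomposing h with the retraction onto the ball gives a map continuous on the whole space with
    coordinates bounded by 1, as [brouwer_cube] asks. Its fixed point is a value of h, hence in the
    ball, where the retraction is the identity. *)
Theorem brouwer_ball n (h : 'rV[R]_n.+1 -> 'rV[R]_n.+1) :
  {within @euclidean_ball R n.+1, continuous h} ->
  (forall x, euclidean_ball x -> euclidean_ball (h x)) ->
  exists2 x, euclidean_ball x & h x = x.
Proof.
move=> ch hB.
have [||x xE] := @brouwer_cube R n (h \o @ball_retract n.+1).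
- apply/continuous_subspace_setT.
  apply: (within_continuous_comp_on _ ch); last by move=> x _; exact: ball_retract_in.
  by apply: continuous_subspaceT; exact: ball_retract_continuous.
- by move=> x i; apply: ball_coord; apply: hB; exact: ball_retract_in.
have xb : euclidean_ball x by rewrite -xE; apply: hB; exact: ball_retract_in.
by exists x => //; rewrite -[X in h X](ball_retract_id xb).
Qed.

(* A retract of a ball has the fixed point property, whereas the antipodal map of a
   sphere has no fixed point. *)
Lemma ball_sphere_no_retraction (X : topologicalType) (B S : set X) n (r : X -> X) :
  homeomorphic B (@euclidean_ball R n.+1) -> homeomorphic S (@euclidean_sphere R n) ->
  S `<=` B -> {within B, continuous r} -> (forall x, B x -> S (r x)) ->
  ~ (forall x, S x -> r x = x).
Proof.
move=> [f [f' [[cf cf'] fB f'B fK f'K]]] [g [g' [[cg cg'] gS g'S gK g'K]]] SB cr rS rid.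
have sphN y : @euclidean_sphere R n y -> euclidean_sphere (- y).
  by rewrite /euclidean_sphere /= -scaleN1r dotZZ sqrrN expr1n mul1r.
have cN : {within @euclidean_sphere R n, continuous -%R}.
  by apply: continuous_subspaceT; exact: oppr_continuous.
have qS y : euclidean_ball y -> euclidean_sphere (- g (r (f' y))).
  by move=> /f'B /rS /gS /sphN.
have [||y yb yE] := @brouwer_ball n (f \o (g' \o (-%R \o (g \o (r \o f'))))).
- apply: (within_continuous_comp_on _ cf); last by move=> y /qS /g'S /SB.
  apply: (within_continuous_comp_on _ cg'); last by move=> y /qS.
  apply: (within_continuous_comp_on _ cN); last by move=> y /f'B /rS /gS.
  apply: (within_continuous_comp_on _ cg); last by move=> y /f'B /rS.
  by apply: (within_continuous_comp_on cf' cr); exact: f'B.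
- by move=> y /qS /g'S /SB /fB.
pose x := f' y; have xE : g' (- g (r x)) = x.
  by rewrite /x -[in RHS]yE /= fK //; apply: SB; apply: g'S; exact: qS.
have Sx : S x by rewrite -xE; apply: g'S; exact: qS.
have := gS _ Sx; have : g x = - g x.
  by rewrite -[in LHS]xE g'K ?rid //; exact: sphN (gS _ Sx).
move=> /eqP; rewrite -subr_eq0 opprK -mulr2n -scaler_nat scaler_eq0 pnatr_eq0 /= => /eqP ->.
rewrite /euclidean_sphere /= /dot big1 => [/esym /eqP|i _]; first by rewrite oner_eq0.
by rewrite mxE mul0r.
Qed.

End BrouwerBall.

(** * Farkas' lemma *)

Section Farkas.
Variable R : realType.

Lemma dotC n (x y : 'rV[R]_n) : dot x y = dot y x.
Proof. by apply: eq_bigr => i _; rewrite mulrC. Qed.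

Lemma dotDr n (x y z : 'rV[R]_n) : dot x (y + z) = dot x y + dot x z.
Proof. by rewrite /dot -big_split; apply: eq_bigr => i _; rewrite mxE mulrDr. Qed.

Lemma dotZr n a (x y : 'rV[R]_n) : dot x (a *: y) = a * dot x y.
Proof. by rewrite /dot mulr_sumr; apply: eq_bigr => i _; rewrite mxE mulrCA. Qed.

Lemma dotDl n (x y z : 'rV[R]_n) : dot (x + y) z = dot x z + dot y z.
Proof. by rewrite dotC dotDr !(dotC z). Qed.

Lemma dotZl n a (x y : 'rV[R]_n) : dot (a *: x) y = a * dot x y.
Proof. by rewrite dotC dotZr dotC. Qed.

Lemma dotNl n (x y : 'rV[R]_n) : dot (- x) y = - dot x y.
Proof. by rewrite -scaleN1r dotZl mulN1r. Qed.

Lemma dotNr n (x y : 'rV[R]_n) : dot x (- y) = - dot x y.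
Proof. by rewrite dotC dotNl dotC. Qed.

Lemma dotBl n (x y z : 'rV[R]_n) : dot (x - y) z = dot x z - dot y z.
Proof. by rewrite dotDl dotNl. Qed.

Lemma dotBr n (x y z : 'rV[R]_n) : dot x (y - z) = dot x y - dot x z.
Proof. by rewrite dotDr dotNr. Qed.

Lemma dotr0 n (x : 'rV[R]_n) : dot x 0 = 0.
Proof. by rewrite /dot big1 // => i _; rewrite mxE mulr0. Qed.

Lemma dot_sumr n (I : Type) (s : seq I) (x : 'rV[R]_n) (w : I -> R) (u : I -> 'rV[R]_n) :
  dot x (\sum_(i <- s) w i *: u i) = \sum_(i <- s) w i * dot x (u i).
Proof.
elim: s => [|i s IH]; first by rewrite !big_nil dotr0.
by rewrite !big_cons dotDr dotZr IH.
Qed.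

Lemma dot_eq0 n (x : 'rV[R]_n) : dot x x = 0 -> x = 0.
Proof.
move=> /eqP; rewrite psumr_eq0 => [/allP H|i _]; last by rewrite -expr2 sqr_ge0.
apply/rowP => i; have := H i (mem_index_enum i).
by rewrite implyTb mulf_eq0 orbb mxE => /eqP.
Qed.

(* Induction on s: a functional c violating the hypothesis for the tail must be negative on u a, and
   projecting along u a onto the kernel of c eliminates u a. *)
Theorem farkas n (T : eqType) (s : seq T) (u : T -> 'rV[R]_n) (b : 'rV[R]_n) : uniq s ->
  (forall c, (forall v, v \in s -> 0 <= dot c (u v)) -> 0 <= dot c b) ->
  exists2 w : T -> R, (forall v, 0 <= w v) & b = \sum_(v <- s) w v *: u v.
Proof.
elim: s u b => [|a s IH] u b /=.
  move=> _ H; exists (fun=> 0) => //; rewrite big_nil; apply: dot_eq0; apply/eqP.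
  have := H (- b) (fun v (h : v \in [::]) => False_ind _ (notF h)).
  by rewrite dotNl oppr_ge0 eq_le dotxx_ge0 andbT.
move=> /andP[aNs us] H.
have [Hs|] := pselect (forall c, (forall v, v \in s -> 0 <= dot c (u v)) -> 0 <= dot c b).
  have [w w0 ->] := IH u b us Hs.
  exists (fun v => if v == a then 0 else w v) => [v|]; first by case: eqP.
  rewrite big_cons eqxx scale0r add0r; apply: eq_big_seq => v vs.
  by case: eqP vs aNs => // -> ->.
move=> /existsNP[c /not_implyP[cs /negP]]; rewrite -ltNge => cb.
have ca : dot c (u a) < 0.
  rewrite ltNge; apply/negP => ca; move: cb; rewrite ltNge H // => v.
  by rewrite in_cons => /predU1P[->//|/cs].
have ca0 : dot c (u a) != 0 by rewrite lt_eqF.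
pose pr x := x - (dot c x / dot c (u a)) *: u a.
have [c' c's|w w0 bE] := IH (fun v => pr (u v)) (pr b) us.
  (* The pullback of c' along the projection [pr]; it vanishes at [u a]. *)
  pose c2 := c' - (dot c' (u a) / dot c (u a)) *: c.
  have c2E x : dot c' (pr x) = dot c2 x.
    rewrite /pr /c2 dotBr dotZr dotBl dotZl; congr (_ - _).
    by rewrite mulrAC [RHS]mulrAC (mulrC (dot c x)).
  rewrite c2E; apply: H => v; rewrite in_cons => /predU1P[->|/c's]; last by rewrite c2E.
  by rewrite -c2E /pr divff // scale1r subrr dotr0.
pose wa := dot c b / dot c (u a) - \sum_(v <- s) w v * (dot c (u v) / dot c (u a)).
have wa0 : 0 <= wa.
  rewrite subr_ge0; apply: (@le_trans _ _ 0).
    rewrite big_seq; apply: sumr_le0 => v vs; apply: mulr_ge0_le0 => //.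
    by apply: mulr_ge0_le0; [exact: cs|rewrite invr_le0 ltW].
  by rewrite mulr_le0 ?invr_le0 // ltW.
exists (fun v => if v == a then wa else w v) => [v|]; first by case: eqP.
rewrite big_cons eqxx.
have -> : \sum_(v <- s) (if v == a then wa else w v) *: u v = \sum_(v <- s) w v *: u v.
  by apply: eq_big_seq => v vs; case: eqP vs aNs => // -> ->.
have prE : \sum_(v <- s) w v *: pr (u v) = \sum_(v <- s) w v *: u v -
    \sum_(v <- s) (w v * (dot c (u v) / dot c (u a))) *: u a.
  by rewrite -sumrB; apply: eq_bigr => v _; rewrite /pr scalerBr scalerA.
rewrite -[LHS](subrK ((dot c b / dot c (u a)) *: u a)) -/(pr b).
rewrite bE prE /wa scalerBl scaler_suml addrAC [RHS]addrAC.
by congr (_ - _); exact: addrC.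
Qed.

End Farkas.

(** * Simplicial polytopes and affine dependencies *)

(* A realization of S as the boundary complex of a simplicial polytope with vertex set V, in homogeneous
   coordinates: u v lies in the hyperplane c0 . x = 1, and an affine function is a linear form c. *)
Record realization (R : realType) (K : choiceType) (m : nat) (S : set {fset K})
    (V : {fset K}) (u : K -> 'rV[R]_m) (c0 : 'rV[R]_m) : Prop := Realization {
  real_sub : forall A B : {fset K}, (A `<=` B)%fset -> S B -> S A;
  real_vertices : forall A, S A -> (A `<=` V)%fset;
  real_height : forall v, v \in V -> dot c0 (u v) = 1;
  real_support : forall A, S A -> exists c,
    [/\ forall v, v \in V -> 0 <= dot c (u v), forall v, v \in A -> dot c (u v) = 0,
        forall v, v \in V -> dot c (u v) = 0 -> v \in A & exists2 v, v \in V & v \notin A];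
  real_face : forall c, (forall v, v \in V -> 0 <= dot c (u v)) ->
    (exists2 v, v \in V & 0 < dot c (u v)) -> S [fset v in V | dot c (u v) == 0]%fset;
  real_free : forall A, S A -> forall w : K -> R, \sum_(v <- A) w v *: u v = 0 ->
    forall v, v \in A -> w v = 0 }.

Section Circuits.
Variables (R : realType) (K : choiceType).

(** The ratio test of the simplex method: t is the least [h v / g v] with [0 < g v], so [h - t g]
    stays nonnegative on s and first vanishes at x. *)
Lemma ratio_test (s : seq K) (h g : K -> R) :
  (forall v, v \in s -> 0 <= h v) -> (exists2 v, v \in s & 0 < g v) ->
  exists t, exists2 x, [/\ x \in s, 0 < g x & h x = t * g x] &
    forall v, v \in s -> t * g v <= h v.
Proof.
move=> h0 [a av ga].
have ia : (index a s < size s)%N by rewrite index_mem.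
pose P (i : 'I_(size s)) := 0 < g (nth a s i).
have Pa : P (Ordinal ia) by rewrite /P /= nth_index.
have [i Pi iP] := arg_minP (fun i : 'I_(size s) => h (nth a s i) / g (nth a s i)) Pa.
exists (h (nth a s i) / g (nth a s i)); exists (nth a s i).
  by split=> //; rewrite ?mem_nth // divfK // gt_eqF.
have t0 : 0 <= h (nth a s i) / g (nth a s i).
  by rewrite divr_ge0 ?h0 ?mem_nth // ltW.
move=> v vs; have [gv|gv] := ltrP 0 (g v); last first.
  by apply: le_trans (h0 v vs); apply: mulr_ge0_le0.
have iv : (index v s < size s)%N by rewrite index_mem.
have := iP (Ordinal iv); rewrite /P /= nth_index // => /(_ gv).
by rewrite ler_pdivlMr.
Qed.

Lemma exists_dependency m d (M : 'M[R]_(d, m)) (u : K -> 'rV[R]_m) (C : {fset K}) :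
  (forall v, v \in C -> (u v <= M)%MS) -> (d < #|` C|)%N ->
  exists w : K -> R, [/\ forall v, v \notin C -> w v = 0,
    exists2 v, v \in C & w v != 0 & \sum_(v <- C) w v *: u v = 0].
Proof.
move=> uM dC; have [x0 x0C] : exists x, x \in C.
  by apply/fset0Pn; rewrite -cardfs_gt0 (leq_ltn_trans _ dC).
pose A := \matrix_(i < #|` C|) u (nth x0 C i).
have AM : (A <= M)%MS.
  by apply/row_subP => i; rewrite rowK; apply: uM; rewrite mem_nth.
have : kermx A != 0.
  rewrite kermx_eq0 -row_leq_rank -ltnNge; apply: leq_ltn_trans dC.
  exact: leq_trans (mxrankS AM) (rank_leq_row M).
move=> /matrix0Pn[i [j kij]].
pose w v := if insub (index v C) is Some l then kermx A i l else 0.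
have wE (l : 'I_#|` C|) : w (nth x0 C l) = kermx A i l.
  by rewrite /w index_uniq ?fset_uniq // valK.
exists w; split.
- move=> v vC; rewrite /w insubF //.
  by apply/negbTE; rewrite index_mem.
- by exists (nth x0 C j); rewrite ?mem_nth // wE.
rewrite (big_nth x0) big_mkord; have := congr1 (row i) (mulmx_ker A).
rewrite row_mul row0 mulmx_sum_row => kA; apply: etrans kA; apply: eq_bigr => l _.
rewrite rowK wE; congr (_ *: _); rewrite [RHS]mxE; exact: erefl.
Qed.

Section Realized.
Variables (m : nat) (S : set {fset K}) (V : {fset K}) (u : K -> 'rV[R]_m) (c0 : 'rV[R]_m).
Hypothesis rS : realization S V u c0.

(* Otherwise a supporting hyperplane of the facet A could be rotated about A until it meets a
   further vertex. *)
Lemma realization_rank d : (exists2 A, S A & #|` A| = d) ->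
  (forall A, S A -> (#|` A| <= d)%N) ->
  exists M : 'M[R]_(d.+1, m), forall v, v \in V -> (u v <= M)%MS.
Proof.
move=> [A SA Ad] Sd.
have [c [cV cA cNA [v0 v0V v0A]]] := real_support rS SA.
pose M := \matrix_(i < d.+1) u (nth v0 (v0 :: A) i).
exists M => v1 v1V; apply: contraT; rewrite submxE => /rV0Pn[j].
rewrite !mxE => Hj; exfalso.
(* A column of the cokernel of M: a linear form that vanishes on the rows of M but not at [u v1]. *)
have [g gE] : exists g : 'rV[R]_m, forall x : 'rV[R]_m, dot g x = (x *m cokermx M) 0 j.
  exists (col j (cokermx M))^T => x; rewrite dotC mxE.
  by apply: eq_bigr => i _; rewrite !mxE.
have gM v : v \in v0 :: (A : seq K) -> dot g (u v) = 0.
  move=> vM; have iv : (index v (v0 :: A) < d.+1)%N by rewrite -Ad -[X in (_ < X.+1)%N]/(size A) index_mem.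
  have := congr1 (row (Ordinal iv)) (mulmx_coker M).
  rewrite row_mul rowK row0 /= nth_index // gE => ->.
  by rewrite mxE.
have [g' [g'1 g'M]] : exists g' : 'rV[R]_m, 0 < dot g' (u v1) /\
    forall v, v \in v0 :: (A : seq K) -> dot g' (u v) = 0.
  have : dot g (u v1) != 0 by rewrite gE mxE.
  rewrite neq_lt => /orP[gn|gp]; last by exists g.
  exists (- g); rewrite dotNl oppr_gt0; split=> // v /gM gv.
  by rewrite dotNl gv oppr0.
(* Tilting c by [g'] keeps it zero on A and positive at [v0], so its zero set is again a face; it
   contains A and the new vertex x, one vertex too many. *)
have [|t [x [xV gx hx] xP]] := @ratio_test V (fun v => dot c (u v)) (fun v => dot g' (u v)) cV.
  by exists v1.
have dE v : dot (c - t *: g') (u v) = dot c (u v) - t * dot g' (u v).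
  by rewrite dotBl dotZl.
have SF : S [fset v in V | dot (c - t *: g') (u v) == 0]%fset.
  apply: (real_face rS) => [v vV|]; first by rewrite dE subr_ge0 xP.
  exists v0 => //; rewrite dE g'M ?in_cons ?eqxx // mulr0 subr0 lt_neqAle cV // andbT eq_sym.
  by apply: contraNneq v0A; exact: cNA.
have := Sd _ SF; rewrite leqNgt -Ad => /negP[].
have xA : x \notin A.
  by apply/negP => xA; move: gx; rewrite g'M ?in_cons ?xA ?orbT // ltxx.
have <- : #|` (x |` A)%fset| = #|` A|.+1 by rewrite cardfsU1 xA.
apply: fsubset_leq_card; apply/fsubsetP => v; rewrite !inE dE /=.
case/predU1P => [->|vA]; first by rewrite xV hx subrr eqxx.
have vV := fsubsetP (real_vertices rS SA) v vA.
by rewrite vV cA // g'M ?in_cons ?vA ?orbT // mulr0 subrr eqxx.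
Qed.

(** The factor a >= 0 expresses conformality to w. While the support has more than d + 1 elements,
    it stays dependent after removal of one vertex; subtracting a multiple of that dependency kills
    a coefficient without changing any sign, and the removed vertex keeps the result nonzero. *)
Lemma conformal_circuit d (M : 'M[R]_(d, m)) (w : K -> R) :
  (forall v, v \in V -> (u v <= M)%MS) ->
  (exists2 v, v \in V & w v != 0) -> \sum_(v <- V) w v *: u v = 0 ->
  exists a : K -> R, [/\ forall v, v \in V -> 0 <= a v, exists2 v, v \in V & a v * w v != 0,
    \sum_(v <- V) (a v * w v) *: u v = 0 &
    (#|` [fset v in V | (a v * w v != 0)%R]%fset| <= d.+1)%N].
Proof.
move=> uM.
have [k] := ubnP #|` [fset v in V | w v != 0]%fset|.
elim: k w => // k IH w; rewrite ltnS => wk wn0 ws.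
have [Cd|dC] := leqP #|` [fset v in V | w v != 0]%fset| d.+1.
  exists (fun=> 1); split=> //.
  - by have [v vV wv] := wn0; exists v; rewrite ?mul1r.
  - by apply: etrans ws; apply: eq_bigr => v _; rewrite mul1r.
  - rewrite (_ : [fset v in V | 1 * w v != 0]%fset = [fset v in V | w v != 0]%fset) //.
    by apply/fsetP => v; rewrite !inE mul1r.
have [v1 v1V wv1] := wn0.
pose C := [fset v in V | w v != 0]%fset.
have v1C : v1 \in C by rewrite !inE v1V.
have CV v : v \in (C `\ v1)%fset -> [/\ v != v1, v \in V & w v != 0].
  by rewrite !inE => /and3P[].
have [||w' [w'0 [v2 v2C w'2] w's]] := @exists_dependency _ _ M u (C `\ v1)%fset.
- by move=> v /CV[_ vV _]; exact: uM.
- by move: dC; rewrite -/C (cardfsD1 v1) v1C.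
(* The sign of the dependency is chosen so that subtracting it shrinks some coefficient of w; the
   ratio test then finds the first one to reach 0. *)
have [b [b0 bs [v3 v3C bv3]]] : exists b : K -> R, [/\ forall v, v \notin (C `\ v1)%fset -> b v = 0,
    \sum_(v <- (C `\ v1)%fset) b v *: u v = 0 & exists2 v, v \in (C `\ v1)%fset & 0 < b v / w v].
  have : w' v2 / w v2 != 0 by have [_ _ ?] := CV _ v2C; rewrite mulf_neq0 ?invr_eq0.
  rewrite neq_lt => /orP[wn|wp]; last by exists w'; split=> //; exists v2.
  exists (fun v => - w' v); split; first by move=> v /w'0 ->; rewrite oppr0.
    by under eq_bigr do rewrite scaleNr; rewrite sumrN w's oppr0.
  by exists v2; rewrite // mulNr oppr_gt0.
have {}bs : \sum_(v <- V) b v *: u v = 0.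
  apply: etrans bs; apply/esym/big_fset_incl => [|v _ vC]; last by rewrite b0 // scale0r.
  by apply/fsubsetP => v /CV[].
have [||t [x [xC gx hx] xP]] := @ratio_test (C `\ v1)%fset (fun=> 1) (fun v => b v / w v) => //.
  by exists v3.
pose a v := 1 - t * (b v / w v).
have aw v : a v * w v = w v - t * b v.
  rewrite /a mulrBl mul1r -mulrA; congr (_ - _ * _).
  have [w0|w0] := eqVneq (w v) 0; last by rewrite divfK.
  by rewrite w0 mulr0 b0 // !inE w0 eqxx /= !andbF.
have a0 v : 0 <= a v.
  rewrite subr_ge0; have [/xP//|vC] := boolP (v \in (C `\ v1)%fset).
  by rewrite b0 // mul0r mulr0 ler01.
have aws : \sum_(v <- V) (a v * w v) *: u v = 0.
  under eq_bigr do rewrite aw scalerBl -scalerA.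
  by rewrite sumrB ws -scaler_sumr bs scaler0 subrr.
have [|||a2 [a20 a2n0 a2s a2d]] := IH (fun v => a v * w v) => //.
- apply: leq_trans wk; apply: fproper_ltn_card; rewrite fproperE; apply/andP; split.
    by apply/fsubsetP => v; rewrite !inE mulf_eq0 negb_or => /and3P[-> _ ->].
  have [_ xV wx] := CV _ xC; apply/negP => /fsubsetP/(_ x).
  by rewrite !inE xV wx /= /a -hx subrr mul0r eqxx => /(_ isT).
- exists v1 => //; rewrite /a b0 ?mul0r ?mulr0 ?subr0 ?mul1r //.
  by rewrite !inE eqxx.
exists (fun v => a2 v * a v); split.
- by move=> v vV; rewrite mulr_ge0 ?a20.
- by have [v vV av] := a2n0; exists v; rewrite -?mulrA.
- by under eq_bigr do rewrite -mulrA.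
- apply: leq_trans a2d; apply: fsubset_leq_card; apply/fsubsetP => v.
  by rewrite !inE mulrA.
Qed.

(** A form supporting the positive part as a face makes every term of the dependency nonpositive,
    hence zero. As it vanishes only on that part, no weight is negative, and evaluating the height
    [c0] then kills all the weights. *)
Lemma dependency_positive_side (w : K -> R) : (exists2 v, v \in V & w v != 0) ->
  \sum_(v <- V) w v *: u v = 0 -> ~ S [fset v in V | 0 < w v]%fset.
Proof.
move=> [v0 v0V wv0] ws SP.
have [c [cV cP cNP _]] := real_support rS SP.
have le0 v : v \in V -> w v * dot c (u v) <= 0.
  move=> vV; have [wv|wv] := ltrP 0 (w v); last by rewrite mulr_le0_ge0 ?cV.
  by rewrite cP ?mulr0 // !inE vV.
have sumD x : \sum_(v <- V) w v * dot x (u v) = 0 by rewrite -dot_sumr ws dotr0.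
have eq0 v : v \in V -> w v * dot c (u v) = 0.
  move=> vV; apply/eqP; rewrite -oppr_eq0; move/eqP: (sumD c).
  rewrite -oppr_eq0 -sumrN big_seq psumr_eq0 => [/allP/(_ v vV)|i iV]; last by rewrite oppr_ge0 le0.
  by rewrite vV.
have w0 v : v \in V -> 0 <= w v.
  move=> vV; rewrite leNgt; apply/negP => wv.
  have /eqP := eq0 v vV; rewrite mulf_eq0 lt_eqF //= => /eqP /(cNP v vV).
  by rewrite !inE vV /= ltNge ltW.
have := sumD c0; rewrite big_seq.
under eq_bigr => v vV do rewrite (real_height rS vV) mulr1.
move/eqP; rewrite -big_seq big_seq psumr_eq0 => [/allP/(_ v0 v0V)|i /w0 //].
by rewrite v0V (negbTE wv0).
Qed.

Lemma dependency_sides d (w : K -> R) : (exists2 A, S A & #|` A| = d) ->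
  (forall A, S A -> (#|` A| <= d)%N) ->
  (exists2 v, v \in V & w v != 0) -> \sum_(v <- V) w v *: u v = 0 ->
  exists P N : {fset K}, [/\ ~ S P /\ ~ S N, forall v, v \in P -> v \in V /\ 0 < w v,
    forall v, v \in N -> v \in V /\ w v < 0 & (#|` P| + #|` N| <= d.+2)%N].
Proof.
move=> dA dS wn0 ws; have [M uM] := realization_rank dA dS.
have [a [a0 an0 as0 ad]] := conformal_circuit uM wn0 ws.
have sgn v : v \in V -> 0 < a v * w v -> 0 < w v.
  by move=> /a0; rewrite le0r => /predU1P[->|/pmulr_rgt0 ->//]; rewrite mul0r ltxx.
have sgn' v : v \in V -> 0 < - (a v * w v) -> w v < 0.
  rewrite -mulrN -oppr_gt0.
  by move=> /a0; rewrite le0r => /predU1P[->|/pmulr_rgt0 ->//]; rewrite mul0r ltxx.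
exists [fset v in V | 0 < a v * w v]%fset, [fset v in V | 0 < - (a v * w v)]%fset.
split.
- split; first exact: dependency_positive_side.
  apply: dependency_positive_side; first by have [v vV av] := an0; exists v; rewrite ?oppr_eq0.
  by under eq_bigr do rewrite scaleNr; rewrite sumrN as0 oppr0.
- by move=> v; rewrite !inE => /andP[vV /(sgn v vV)].
- by move=> v; rewrite !inE => /andP[vV /(sgn' v vV)].
rewrite -cardfsUI (_ : (_ `&` _)%fset = fset0) ?cardfs0 ?addn0; last first.
  apply/fsetP => v; rewrite !inE; apply/negbTE/negP => /andP[/andP[_ h] /andP[_]].
  by rewrite oppr_gt0 ltNge ltW.
apply: leq_trans ad; apply: fsubset_leq_card; apply/fsubsetP => v; rewrite !inE /=.
by case/orP => /andP[->] h /=; rewrite ?(gt_eqF h) // -oppr_eq0 (gt_eqF h).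
Qed.

End Realized.
End Circuits.

(** * Vertices and faces of polytopes *)

Section Hulls.
Variable R : realType.

Definition homog n (v : 'rV[R]_n) : 'rV[R]_(1 + n) := row_mx (const_mx 1) v.

Lemma dot_row_mx n (a : R) (c v : 'rV[R]_n) :
  dot (row_mx (const_mx a) c) (homog v) = a + dot c v.
Proof.
rewrite /dot big_split_ord big_ord1; congr (_ + _).
  by rewrite !row_mxEl !mxE mulr1.
by apply: eq_bigr => i _; rewrite !row_mxEr.
Qed.

Lemma homog_functional n (c : 'rV[R]_(1 + n)) :
  exists (a : R) (c' : 'rV[R]_n), forall v, dot c (homog v) = a + dot c' v.
Proof.
exists (lsubmx c 0 0), (rsubmx c) => v; rewrite -dot_row_mx; congr (dot _ _).
rewrite -[LHS]hsubmxK; congr row_mx.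
by apply/matrixP => i j; rewrite !ord1 [RHS]mxE.
Qed.

Lemma homog_sum n (T : Type) (s : seq T) (w : T -> R) (f : T -> 'rV[R]_n) :
  \sum_(v <- s) w v *: homog (f v) =
  row_mx (const_mx (\sum_(v <- s) w v)) (\sum_(v <- s) w v *: f v).
Proof.
elim: s => [|v s IH].
  by rewrite !big_nil -[LHS]hsubmxK; congr row_mx; apply/matrixP => i j; rewrite !mxE.
rewrite !big_cons IH scale_row_mx add_row_mx; congr row_mx.
by apply/matrixP => i j; rewrite !mxE mulr1.
Qed.

Lemma homog_inj n (a b : R) (x y : 'rV[R]_n) :
  row_mx (const_mx a : 'rV_1) x = row_mx (const_mx b) y -> a = b /\ x = y.
Proof. by move=> /eq_row_mx[/matrixP/(_ 0 0)]; rewrite !mxE. Qed.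

Lemma hull_homog n (A : {fset 'rV[R]_n}) x : conv_hull A x <->
  exists w : 'rV[R]_n -> R, (forall v, v \in A -> 0 <= w v) /\
    homog x = \sum_(v <- A) w v *: homog v.
Proof.
split=> [[w [w0 w1 ->]]|[w [w0]]].
  by exists w; split=> //; rewrite (homog_sum _ _ id) w1.
by rewrite (homog_sum _ _ id) => /homog_inj[w1 wx]; exists w.
Qed.

Lemma hull_trans n (A B : {fset 'rV[R]_n}) x :
  (forall v, v \in A -> conv_hull B v) -> conv_hull A x -> conv_hull B x.
Proof.
move=> AB [w [w0 w1 ->]].
pose P v (m : 'rV[R]_n -> R) := v \in A -> [/\ forall b, b \in B -> 0 <= m b,
  \sum_(b <- B) m b = 1 & v = \sum_(b <- B) m b *: b].
have /choice[mu muP] : forall v, exists m, P v m.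
  move=> v; rewrite /P.
  have [/AB[m mP]|vA] := boolP (v \in A); first by exists m.
  by exists (fun=> 0).
exists (fun b => \sum_(v <- A) w v * mu v b); split.
- move=> b bB; rewrite big_seq; apply: sumr_ge0 => v vA.
  by rewrite mulr_ge0 ?w0 //; have [->] := muP v vA.
- rewrite exchange_big -[RHS]w1 big_seq [RHS]big_seq; apply: eq_bigr => v vA.
  by rewrite -mulr_sumr; have [_ -> _] := muP v vA; rewrite mulr1.
- under [RHS]eq_bigr do rewrite scaler_suml.
  rewrite exchange_big big_seq [RHS]big_seq; apply: eq_bigr => v vA.
  have [_ _ vE] := muP v vA; rewrite [X in w v *: X]vE scaler_sumr.
  by apply: eq_bigr => b _; rewrite scalerA.
Qed.

Lemma hull_mem n (A : {fset 'rV[R]_n}) v : v \in A -> conv_hull A v.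
Proof.
move=> vA; exists (fun u => (u == v)%:R); split; first by move=> u _; rewrite ler0n.
  rewrite (big_fsetD1 v) //= eqxx big_seq big1 ?addr0 // => u.
  by rewrite !inE => /andP[/negbTE ->].
rewrite (big_fsetD1 v) //= eqxx scale1r big_seq big1 ?addr0 // => u.
by rewrite !inE => /andP[/negbTE -> _]; rewrite scale0r.
Qed.

Lemma hull_sub n (A B : {fset 'rV[R]_n}) : (A `<=` B)%fset -> conv_hull A `<=` conv_hull B.
Proof. by move=> /fsubsetP AB x; apply: hull_trans => v /AB /hull_mem. Qed.

Lemma hull1 n (v x : 'rV[R]_n) : conv_hull [fset v]%fset x -> x = v.
Proof. by move=> [w [_]]; rewrite !big_seq_fset1 => -> ->; rewrite scale1r. Qed.

Lemma hull_le n (A : {fset 'rV[R]_n}) c b x : (forall v, v \in A -> dot c v <= b) ->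
  conv_hull A x -> dot c x <= b.
Proof.
move=> Ab [w [w0 w1 ->]]; rewrite dot_sumr -[leRHS]mul1r -w1 mulr_suml big_seq [leRHS]big_seq.
by apply: ler_sum => v vA; rewrite ler_wpM2l ?w0 ?Ab.
Qed.

Lemma hull_eq n (A : {fset 'rV[R]_n}) c b x : (forall v, v \in A -> dot c v = b) ->
  conv_hull A x -> dot c x = b.
Proof.
move=> Ab Ax; apply/eqP; rewrite eq_le (hull_le _ Ax) => [|v /Ab->//].
by rewrite -lerN2 -!dotNl (hull_le _ Ax) // => v /Ab; rewrite dotNl => ->.
Qed.

(** The slacks [b - dot c v], weighted as in a convex combination for x, are nonnegative and sum to
    0, so only points without slack carry weight. *)
Lemma hull_face n (A : {fset 'rV[R]_n}) c b x : (forall v, v \in A -> dot c v <= b) ->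
  conv_hull A x -> dot c x = b -> conv_hull [fset v in A | dot c v == b]%fset x.
Proof.
move=> Ab [w [w0 w1 xE]] xb.
have w0' v : v \in A -> v \notin [fset v in A | dot c v == b]%fset -> w v = 0.
  move=> vA; rewrite !inE vA /= => vb.
  have : \sum_(v <- A) w v * (b - dot c v) = 0.
    under eq_bigr do rewrite mulrBr.
    by rewrite sumrB -mulr_suml w1 mul1r -dot_sumr -xE xb subrr.
  move/eqP; rewrite big_seq psumr_eq0 => [/allP/(_ v vA)|u uA]; last first.
    by rewrite mulr_ge0 ?w0 // subr_ge0 Ab.
  by rewrite vA mulf_eq0 subr_eq0 (eq_sym b) (negbTE vb) orbF => /eqP.
have sub : ([fset v in A | dot c v == b] `<=` A)%fset by exact: fset_sub.
exists w; split; first by move=> v /(fsubsetP sub)/w0.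
  by rewrite -[RHS]w1; apply/big_fset_incl.
by rewrite xE; apply/esym/big_fset_incl => // v vA vN; rewrite w0' ?scale0r.
Qed.

Lemma vertex_in_hull n (P : set 'rV[R]_n) (B : {fset 'rV[R]_n}) v :
  polytope_vertex P v -> (forall u, u \in B -> P u) -> conv_hull B v -> v \in B.
Proof.
move=> [c [b [cP vE]]] BP Bv.
have vb : dot c v = b by have : [set v] v by []; rewrite vE => -[].
have [w [_ w1 _]] := hull_face (fun u uB => cP u (BP u uB)) Bv vb.
have [u] : exists u, u \in [fset u in B | dot c u == b]%fset.
  apply/fset0Pn; apply/eqP => B0; move: w1; rewrite B0 big_seq_fset0 => /eqP.
  by rewrite eq_sym oner_eq0.
rewrite !inE => /andP[uB /eqP ub].
by have : [set v] u; [rewrite vE; split=> //; exact: BP|move=> <-].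
Qed.

(** A point in the hull of the others can be discarded. Any other point is separated from them by
    Farkas' lemma in homogeneous coordinates, and the separating form exposes it as a vertex. *)
Lemma polytope_vertices n (A : {fset 'rV[R]_n}) : exists2 V : {fset 'rV[R]_n},
  conv_hull A = conv_hull V & forall v, v \in V -> polytope_vertex (conv_hull A) v.
Proof.
have [k] := ubnP #|` A|; elim: k A => // k IH A; rewrite ltnS => Ak.
have [AV|] := pselect (forall v, v \in A -> polytope_vertex (conv_hull A) v).
  by exists A.
move=> /existsNP[v /not_implyP[vA vN]].
suff Av : conv_hull (A `\ v)%fset v.
  have AE : conv_hull A = conv_hull (A `\ v)%fset.
    apply/seteqP; split; last by apply: hull_sub; exact: fsubD1set.
    move=> x; apply: hull_trans => u uA.
    by have [->//|uv] := eqVneq u v; apply: hull_mem; rewrite !inE uv.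
  rewrite AE; apply: IH; apply: leq_trans Ak.
  by rewrite [X in (_ < X)%N](cardfsD1 v) vA.
apply: contrapT => Av; apply: vN.
have [c [cA cv]] : exists c, (forall u, u \in (A `\ v)%fset -> 0 <= dot c (homog u)) /\
    dot c (homog v) < 0.
  apply: contrapT => H; apply/Av/hull_homog.
  have [||w w0 wE] := @farkas _ _ _ (A `\ v)%fset (@homog n) (homog v); last by exists w.
    exact: fset_uniq.
  move=> c cA; rewrite leNgt; apply/negP => cv; apply: H; by exists c.
have [a [c' cE]] := homog_functional c.
have le u : u \in A -> dot (- c') u <= dot (- c') v ?= iff (u == v).
  have [->|uv] := eqVneq u v; first by move=> _; split; rewrite ?lexx ?eqxx.
  move=> uA; have : dot (- c') u < dot (- c') v.
    have := cA u; rewrite !inE uv uA => /(_ isT); move: cv; rewrite !cE !dotNl.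
    lra.
  by move=> lt; split; [exact: ltW|rewrite lt_eqF].
exists (- c'), (dot (- c') v); split.
  by move=> x; apply: hull_le => u /le [].
apply/seteqP; split=> [x ->|x [Ax /(hull_face _ Ax)]]; first by split=> //; exact: hull_mem.
have -> : [fset u in A | dot (- c') u == dot (- c') v]%fset = [fset v]%fset.
  apply/fsetP => u; rewrite !inE; have [uA|uA] := boolP (u \in A); first by case: (le u uA).
  by apply/esym/negbTE; apply: contraNneq uA => ->.
by move=> H; apply: hull1; apply: H => u /le [].
Qed.

Lemma affinely_independent_sub n (A B : {fset 'rV[R]_n}) : (A `<=` B)%fset ->
  affinely_independent B -> affinely_independent A.
Proof.
move=> AB Bi w w0 wv0 v vA.
pose w' u := if u \in A then w u else 0.
have E (T : nmodType) (F : 'rV[R]_n -> T) : (forall u, u \notin A -> F u = 0) ->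
    \sum_(u <- B) F u = \sum_(u <- A) F u.
  by move=> F0; apply/esym/big_fset_incl => // u _ /F0.
have := Bi w' _ _ v (fsubsetP AB v vA); rewrite /w' vA; apply.
  rewrite E => [|u /negbTE -> //]; rewrite -[RHS]w0 big_seq [RHS]big_seq.
  by apply: eq_bigr => u ->.
rewrite E => [|u /negbTE ->]; last by rewrite scale0r.
apply: etrans wv0; rewrite big_seq [RHS]big_seq.
by apply: eq_bigr => u ->.
Qed.
End Hulls.

(** The points are the images under f in homogeneous coordinates. The work lies in matching V with
    the vertices of P ([Wf]): each vertex of P is by itself a proper face, hence comes from a face
    of S. *)
Theorem polytopal_realization (R : realType) (K : choiceType) (S : set {fset K}) :
  simplicial_complex S -> (exists2 A, S A & A != fset0) -> polytopal R S ->
  exists m (V : {fset K}) (u : K -> 'rV[R]_m) (c0 : 'rV[R]_m), realization S V u c0.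
Proof.
move=> [Sfin S0 Ssub] [A0 SA0 A0n0] [n [P [f [[[A PA] Psimp] finj bdE]]]].
have [W PW WV] := polytope_vertices A; rewrite -PA in PW WV.
have WP v : v \in W -> P v by move=> vW; rewrite PW; exact: hull_mem.
have vertW v : polytope_vertex P v -> v \in W.
  move=> vP; apply: (vertex_in_hull vP) => //; rewrite -PW.
  by have [c [b [_ E]]] := vP; have : [set v] v by []; rewrite E => -[].
have bdS X : S X -> boundary_complex P [fset f x | x in X]%fset by move=> SX; rewrite bdE; exists X.
have Vfin : finite_set (vertices S).
  apply: (@finite_preimage _ _ S (fun x : K => [fset x]%fset)) => //.
  by move=> x y _ _ /fset1_inj.
pose V := fset_set (vertices S).
have inV x : (x \in V) = `[< vertices S x >] by rewrite in_fset_set.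
have SV X : S X -> (X `<=` V)%fset.
  move=> SX; apply/fsubsetP => x xX; rewrite inV; apply/asboolP.
  by apply: (Ssub _ _ SX); rewrite fsub1set.
have fVinj x y : x \in V -> y \in V -> f x = f y -> x = y.
  by rewrite !inV => /asboolP Sx /asboolP; exact: finj.
have fVW x : x \in V -> f x \in W.
  rewrite inV => /asboolP /bdS [H _]; apply/vertW/H.
  by apply/imfsetP; exists x; rewrite ?inE.
have Wf y : y \in W -> exists2 x, x \in V & f x = y.
  move=> yW; suff : boundary_complex P [fset y]%fset.
    rewrite bdE => -[X SX /fsetP/(_ y)]; rewrite !inE eqxx => /imfsetP[x /= xX ->].
    by exists x => //; exact: (fsubsetP (SV _ SX)).
  have hy : conv_hull [fset y]%fset = [set y].
    apply/seteqP; split=> [x /hull1|x ->] //; apply: hull_mem; exact: fset11.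
  split=> [v|]; first by rewrite inE => /eqP ->; exact: WV.
  rewrite hy; split; first exact: WV.
  (* If P were the single point y, the image of a nonempty face of S would span all of P and could
     not be a proper face. *)
  move=> yP; have [bv [_]] := bdS _ SA0; apply; rewrite -yP.
  have [x xA0] := fset0Pn _ A0n0.
  have fxA : f x \in [fset f x | x in A0]%fset by apply/imfsetP; exists x.
  have sub z : z \in [fset f x | x in A0]%fset -> z = y.
    by move=> /bv /vertW /WP; rewrite -yP.
  apply/seteqP; split=> [z|z ->]; last by rewrite -(sub _ fxA); exact: hull_mem.
  by rewrite -hy; apply: hull_trans => v /sub ->; apply: hull_mem; exact: fset11.
have memf X x : S X -> x \in V -> (f x \in [fset f x | x in X]%fset) = (x \in X).
  move=> SX xV; apply/imfsetP/idP => [[y /= yX fxy]|xX]; last by exists x.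
  by rewrite (fVinj _ _ xV (fsubsetP (SV _ SX) _ yX) fxy).
exists (1 + n)%N, V, (fun v => homog (f v)), (row_mx (const_mx 1) 0); split.
- by move=> X Y XY SY; exact: Ssub SY XY.
- exact: SV.
- by move=> v _; rewrite dot_row_mx dotC dotr0 addr0.
- move=> X SX; have [Xv [[c [b [cP XE]]] XP]] := bdS X SX.
  have cE v : dot (row_mx (const_mx b) (- c)) (homog (f v)) = b - dot c (f v).
    by rewrite dot_row_mx dotNl.
  have hullX v : v \in V -> dot c (f v) = b -> v \in X.
    move=> vV vb; rewrite -(memf _ _ SX vV); apply: (vertex_in_hull (WV _ (fVW v vV))).
      by move=> y /Xv /vertW /WP.
    by rewrite XE; split=> //; exact/WP/fVW.
  exists (row_mx (const_mx b) (- c)); split.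
  + by move=> v vV; rewrite cE subr_ge0; apply/cP/WP/fVW.
  + move=> v vX; have vV := fsubsetP (SV _ SX) v vX.
    have : conv_hull [fset f x | x in X]%fset (f v) by apply: hull_mem; rewrite memf.
    by rewrite XE cE => -[_ ->]; rewrite subrr.
  + by move=> v vV; rewrite cE => /eqP; rewrite subr_eq0 eq_sym => /eqP; exact: hullX.
  + apply: contrapT => H; apply: XP; rewrite PW; apply/seteqP; split.
      by apply: hull_sub; apply/fsubsetP => y /Xv /vertW.
    apply: hull_sub; apply/fsubsetP => y /Wf[x xV <-]; rewrite memf //.
    by apply: contrapT => /negP xX; apply: H; exists x.
- move=> c cV [v0 v0V cv0]; have [a [c' cE]] := homog_functional c.
  have leW y : y \in W -> dot (- c') y <= a.
    by move=> /Wf[x xV <-]; have := cV x xV; rewrite cE dotNl; lra.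
  have : boundary_complex P [fset y in W | dot (- c') y == a]%fset.
    have sub y : y \in [fset y in W | dot (- c') y == a]%fset -> y \in W /\ dot (- c') y = a.
      by rewrite !inE => /andP[-> /eqP].
    split=> [v /sub[/WV]//|]; split.
      exists (- c'), a; split; first by move=> x; rewrite PW; exact: hull_le.
      apply/seteqP; split=> [x Hx|x [Px]].
        split; last by apply: hull_eq Hx => v /sub[].
        by rewrite PW; apply: hull_sub Hx; apply/fsubsetP => v /sub[].
      by rewrite PW in Px *; exact: hull_face.
    move=> E; have : P (f v0) by exact/WP/fVW.
    rewrite -E => /(hull_eq (c := - c') (b := a)) H.
    have : dot (- c') (f v0) = a by apply: H => v /sub[].
    by move: cv0; rewrite cE dotNl; lra.
  rewrite bdE => -[Y SY YE].
  suff -> : [fset v in V | dot c (homog (f v)) == 0]%fset = Y by [].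
  apply/fsetP => v; rewrite !inE; have [vV|vV] := boolP (v \in V); last first.
    by apply/esym/negbTE; apply: contra vV; exact: fsubsetP (SV _ SY) v.
  rewrite -(memf _ _ SY vV) YE !inE fVW //= cE dotNl.
  by apply/eqP/eqP => h; lra.
- move=> X SX w; rewrite (homog_sum _ _ f) => w0 v vX.
  have XV := fsubsetP (SV _ SX).
  have [bv bp] := bdS X SX; have [B [Bi XB]] := Psimp _ bp.
  (* The proper face is conv B with B affinely independent. The image of X consists of vertices of
     P, and a vertex of P lying in conv B belongs to B. *)
  have Xi : affinely_independent [fset f x | x in X]%fset.
    apply: affinely_independent_sub Bi; apply/fsubsetP => y yX.
    apply: (vertex_in_hull (bv _ yX)); last by rewrite -XB; exact: hull_mem.
    move=> u uB; have : conv_hull B u by exact: hull_mem.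
    by rewrite -XB; case: bp => -[c [b [_ ->]]] _ [].
  have fXi : {in X &, injective f} by move=> x y /XV xV /XV; exact: fVinj.
  have [g gK] : exists g : 'rV[R]_n -> K, forall x, x \in X -> g (f x) = x.
    have /choice[g gP] : forall y, exists z, forall x, x \in X -> f x = y -> z = x.
      move=> y; have [[x xX fx]|H] := pselect (exists2 x, x \in X & f x = y).
        by exists x => x' x'X fx'; apply: fXi; rewrite // fx.
      by exists v => x xX fx; exfalso; apply: H; exists x.
    by exists g => x xX; exact: gP.
  have [w1 w2] : \sum_(v <- X) w v = 0 /\ \sum_(v <- X) w v *: f v = 0.
    by move: w0; rewrite -row_mx0 => /eq_row_mx[/matrixP/(_ 0 0)]; rewrite !mxE.
  have := Xi (w \o g) _ _ (f v); rewrite /= gK //; apply; last by rewrite memf // XV.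
  + rewrite big_imfset //=; apply: etrans w1; rewrite big_seq [RHS]big_seq.
    by apply: eq_bigr => x xX; rewrite gK.
  + rewrite big_imfset //=; apply: etrans w2; rewrite big_seq [RHS]big_seq.
    by apply: eq_bigr => x xX; rewrite gK.
Qed.

(** * Surjectivity of the linear map to the polytope *)

(** A closed graph argument: outside a neighbourhood of [g x], the map [G (x, _)] has no zero on the
    rest of C, and by compactness neither has [G (x', _)] for x' close to x. *)
Lemma compact_graph_continuous (R : numFieldType) (X Y : topologicalType)
    (Z : normedModType R) (D : set X) (C : set Y) (G : X * Y -> Z) (g : X -> Y) :
  compact C -> continuous G -> (forall x, D x -> C (g x) /\ G (x, g x) = 0) ->
  (forall x y, D x -> C y -> G (x, y) = 0 -> y = g x) -> {within D, continuous g}.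
Proof.
move=> cC cG gP gU; apply/subspace_continuousP => x Dx W.
rewrite /= nbhsE => -[U [oU Ugx] UW].
have cK : compact (C `&` ~` U) by apply: compact_closedI => //; exact: open_closedC.
have : \forall x' \near x, C `&` ~` U `<=` (fun y => G (x', y) != 0).
  have /compact_near_coveringP cov := cK.
  apply: (cov _ _ (fun x' y => G (x', y) != 0)) => y [Cy Uy].
  have Gxy : G (x, y) != 0 by apply/eqP => /(gU _ _ Dx Cy) yE; apply: Uy; rewrite yE.
  have := cvgr_neq0 _ (cG (x, y)) Gxy.
  move=> [[U1 U2] [/= H1 H2] H]; exists (U2, U1); first by split.
  by move=> [y' x'] /= [h1 h2]; exact: (H (x', y')).
rewrite /nbhs /= /within /=; apply: filterS => x' H Dx'; apply: UW.
apply: contrapT => Ux'; have [Cx' Gx'] := gP _ Dx'.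
by have := H (g x') (conj Cx' Ux'); rewrite Gx' eqxx.
Qed.

Lemma sphere_compact (R : realType) d : compact (@euclidean_sphere R d).
Proof.
have cC : compact [set v : 'rV[R]_d.+1 | forall i, `[-1, 1]%classic (v ord0 i)].
  by apply: (@rV_compact R _ (fun=> `[-1, 1]%classic)) => i; exact: segment_compact.
have cS : closed (@euclidean_sphere R d).
  rewrite (_ : @euclidean_sphere R d = (fun x => dot x x) @^-1` [set 1]) //.
  apply: closed_comp => [x _|]; first exact: dot_continuous.
  exact: closed_eq.
apply: (subclosed_compact cS cC) => x xS i /=.
by rewrite in_itv /= -ler_norml; apply: ball_coord; rewrite /euclidean_ball /= xS.
Qed.

Section ContinuousRows.
Variables (R : realType) (m : nat) (T : topologicalType).
Implicit Types (s : T -> R) (f g : T -> 'rV[R]_m).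

Lemma continuous_rowD f g : continuous f -> continuous g -> continuous (fun x => f x + g x).
Proof. by move=> cf cg x; apply: (@continuousD _ _ _ f g); [exact: cf|exact: cg]. Qed.

Lemma continuous_rowB f g : continuous f -> continuous g -> continuous (fun x => f x - g x).
Proof. by move=> cf cg x; apply: (@continuousB _ _ _ f g); [exact: cf|exact: cg]. Qed.

Lemma continuous_rowZ s f : continuous s -> continuous f -> continuous (fun x => s x *: f x).
Proof. by move=> cs cf x; apply: (@continuousZ _ _ _ s f); [exact: cs|exact: cf]. Qed.

Lemma continuous_rowC (v : 'rV[R]_m) : continuous (fun _ : T => v).
Proof. by move=> x; exact: cst_continuous. Qed.

Lemma continuous_1B s : continuous s -> continuous (fun x => 1 - s x).
Proof.
by move=> cs x; apply: (@continuousB _ R^o _ (fun=> 1) s); [exact: cst_continuous|exact: cs].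
Qed.
End ContinuousRows.

Section Carriers.
Variables (R : realType) (K : choiceType).
Implicit Types (X : set {fset K}) (w : {ptws K -> R}).

Lemma carrier_sub X Y : X `<=` Y -> @carrier R K X `<=` @carrier R K Y.
Proof. by move=> XY w [A [/XY YA w0 wA w1]]; exists A. Qed.

Lemma carrier_compact d X : homeomorphic (@carrier R K X) (@euclidean_sphere R d) ->
  compact (@carrier R K X).
Proof.
move=> [f [g [[_ cg] fS gX gf _]]].
have -> : @carrier R K X = g @` @euclidean_sphere R d.
  apply/seteqP; split=> [w Xw|_ [y ys <-]]; last exact: gX.
  by exists (f w); [exact: fS|exact: gf].
by apply: continuous_compact => //; exact: sphere_compact.
Qed.

Lemma sum_supported (T : nmodType) (V A : {fset K}) (F : K -> T) : (A `<=` V)%fset ->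
  (forall v, v \notin A -> F v = 0) -> \sum_(v <- V) F v = \sum_(v <- A) F v.
Proof. by move=> AV F0; apply/esym/big_fset_incl => // v _ /F0. Qed.

Lemma eval_continuous v : continuous (fun w : {ptws K -> R} => (w v : R)).
Proof. exact: (@proj_continuous K (fun=> R) v). Qed.

Variables (m : nat) (V : {fset K}) (u : K -> 'rV[R]_m).

Definition realize w : 'rV[R]_m := \sum_(v <- V) w v *: u v.

Lemma realize_continuous : continuous realize.
Proof.
apply: (@continuous_bigsum R _ _ _ V (fun v w => w v *: u v)) => v w.
by apply: continuousZr_tmp; exact: eval_continuous.
Qed.

End Carriers.

(** * Radial projection from an interior point of the polytope *)

Section Covering.
Variables (R : realType) (K : choiceType) (m : nat) (S : set {fset K}) (V : {fset K}).
Variables (u : K -> 'rV[R]_m) (c0 : 'rV[R]_m).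
Hypothesis rS : realization S V u c0.
Variable a : K -> R.
Hypothesis a_ge0 : forall v, 0 <= a v.
Hypothesis a_sum : \sum_(v <- V) a v = 1.
Hypothesis a_interior : forall A, S A -> exists2 v, v \in V & (0 < a v) && (v \notin A).

Let p := realize V u a.

Let dot_realize c (w : {ptws K -> R}) :
  dot c (realize V u w) = \sum_(v <- V) w v * dot c (u v).
Proof. exact: dot_sumr. Qed.

Let height (w : {ptws K -> R}) : dot c0 (realize V u w) = \sum_(v <- V) w v.
Proof.
rewrite dot_realize big_seq [RHS]big_seq; apply: eq_bigr => v vV.
by rewrite (real_height rS) ?mulr1.
Qed.

(** c vanishes on no vertex off A, and p gives positive weight to such a vertex. *)
Let interior_pos A c : S A -> (forall v, v \in V -> 0 <= dot c (u v)) ->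
  (forall v, v \in V -> dot c (u v) = 0 -> v \in A) -> 0 < dot c p.
Proof.
move=> /a_interior[v vV /andP[av vA]] cV cA; rewrite dot_realize (big_fsetD1 v) //=.
apply: ltr_wpDr.
  by rewrite big_seq; apply: sumr_ge0 => x; rewrite !inE => /andP[_ xV]; rewrite mulr_ge0 ?cV.
rewrite mulr_gt0 // lt_neqAle cV // andbT eq_sym.
by apply: contraNneq vA; exact: cA.
Qed.

Lemma carrier_face (w : {ptws K -> R}) : @carrier R K S w -> exists2 A, S A &
  [/\ forall v, 0 <= w v, forall v, v \notin A -> w v = 0 & \sum_(v <- V) w v = 1].
Proof.
move=> [A [SA w0 wA w1]]; exists A => //; split=> //.
by rewrite (sum_supported (real_vertices rS SA)).
Qed.

(** The form supporting the face of w' is zero at w', nonnegative at w and positive at p; comparing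
    its values on the two sides orders t and t'. *)
Let ray_le w w' t t' : @carrier R K S w -> @carrier R K S w' -> 0 <= t ->
  (1 - t) *: p + t *: realize V u w = (1 - t') *: p + t' *: realize V u w' ->
  t' <= t.
Proof.
move=> /carrier_face[A SA [w0 wA w1]] /carrier_face[B SB [w0' wB w1']] t0 E.
have [c [cV cB cBN _]] := real_support rS SB.
have cp := interior_pos SB cV cBN.
have cw' : dot c (realize V u w') = 0.
  rewrite dot_realize big1 // => v _.
  by have [/cB ->|/wB ->] := boolP (v \in B); rewrite ?mulr0 ?mul0r.
have cw : 0 <= dot c (realize V u w).
  by rewrite dot_realize big_seq; apply: sumr_ge0 => v vV; rewrite mulr_ge0 ?cV.
have := congr1 (dot c) E; rewrite !dotDr !dotZr cw' mulr0 addr0 => H.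
have : (1 - t) * dot c p <= (1 - t') * dot c p by rewrite -H lerDl mulr_ge0.
by rewrite ler_pM2r //; lra.
Qed.

(** Equality of t and t' is [ray_le] used twice. Then w and w' realize the same point, so the form
    supporting the face of w' forces w onto that face, whose vertices are independent. *)
Lemma ray_unique w w' t t' : @carrier R K S w -> @carrier R K S w' -> 0 <= t -> 0 <= t' ->
  (1 - t) *: p + t *: realize V u w = (1 - t') *: p + t' *: realize V u w' ->
  (1 - t) *: p + t *: realize V u w != p -> w = w' /\ t = t'.
Proof.
move=> Sw Sw' t0 t0' E yp.
have tt' : t = t'.
  by apply/eqP; rewrite eq_le (ray_le Sw' Sw t0' (esym E)) (ray_le Sw Sw' t0 E).
split=> //; rewrite -tt' in E.
have tn0 : t != 0 by apply: contraNneq yp => ->; rewrite subr0 scale1r scale0r addr0.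
have {}E : realize V u w = realize V u w' by apply: (scalerI tn0); move/addrI: E.
have [A SA [w0 wA w1]] := carrier_face Sw; have [B SB [w0' wB w1']] := carrier_face Sw'.
have [c [cV cB cBN _]] := real_support rS SB.
have cw : \sum_(v <- V) w v * dot c (u v) = 0.
  rewrite -dot_realize E dot_realize big1 // => v _.
  by have [/cB ->|/wB ->] := boolP (v \in B); rewrite ?mulr0 ?mul0r.
have wB2 v : v \notin B -> w v = 0.
  move=> vB; have [vV|vV] := boolP (v \in V); last first.
    by apply: wA; apply: contra vV; exact: fsubsetP (real_vertices rS SA) v.
  move: cw => /eqP; rewrite big_seq psumr_eq0 => [/allP/(_ v vV)|x xV]; last by rewrite mulr_ge0 ?cV.
  rewrite vV mulf_eq0 => /orP[/eqP//|/eqP /(cBN v vV)]; by rewrite (negbTE vB).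
have BV := real_vertices rS SB.
have dB : \sum_(v <- B) (w v - w' v) *: u v = 0.
  under eq_bigr do rewrite scalerBl.
  rewrite sumrB -!(@sum_supported _ _ V B) //.
  - by apply/eqP; rewrite subr_eq0; apply/eqP.
  - by move=> v /wB ->; rewrite scale0r.
  - by move=> v /wB2 ->; rewrite scale0r.
apply/funext => v; have [vB|vB] := boolP (v \in B); last by rewrite wB // wB2.
by have /eqP := real_free rS SB dB vB; rewrite subr_eq0 => /eqP.
Qed.

(* Choose y = tau p + sum w_v u_v with tau maximal. By Farkas' lemma, either some positive multiple of p can
   still be split off the sum, or a linear form separates: it vanishes on the sum, whose support is a face. *)
Lemma ray_exists (b : {ptws K -> R}) : (forall v, 0 <= b v) -> \sum_(v <- V) b v = 1 ->
  realize V u b != p -> exists w t, [/\ @carrier R K S w, 0 <= t <= 1 &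
    realize V u b = (1 - t) *: p + t *: realize V u w].
Proof.
move=> b0 b1 yp; set y := realize V u b in yp *.
(* The boxes make this set compact. The total weight is not imposed: the height [c0] forces it to be
   1, so nonnegative weights fit in the boxes once those off V are set to 0. *)
pose E := [set tw : R * {ptws K -> R} | (`[0, 1]%classic tw.1 /\ forall v, `[0, 1]%classic (tw.2 v)) /\
  y - (tw.1 *: p + realize V u tw.2) = 0].
have clE : compact E.
  have cW : compact [set w : {ptws K -> R} | forall v, `[0, 1]%classic (w v)].
    by apply: (@tychonoff K (fun=> R) (fun=> `[0, 1]%classic)) => v; exact: segment_compact.
  have cT := compact_setX (@segment_compact R 0 1) cW.
  have cF : continuous (fun tw : R * {ptws K -> R} => y - (tw.1 *: p + realize V u tw.2)).
    apply: continuous_rowB; first exact: continuous_rowC.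
    apply: continuous_rowD.
      by apply: continuous_rowZ; [move=> tw; exact: cvg_fst|exact: continuous_rowC].
    move=> tw; apply: (@continuous_comp _ _ _ snd (realize V u)); first exact: cvg_snd.
    exact: realize_continuous.
  rewrite (_ : E = (`[0, 1]%classic `*` [set w : {ptws K -> R} | forall v, `[0, 1]%classic (w v)]) `&`
     (fun tw : R * {ptws K -> R} => y - (tw.1 *: p + realize V u tw.2)) @^-1` [set 0]); last first.
    by apply/seteqP; split.
  apply: compact_closedI => //.
  apply: closed_comp => [tw _|]; first exact: cF.
  exact/accessible_closed_set1/hausdorff_accessible/norm_hausdorff.
have wE (tau : R) (w : {ptws K -> R}) : 0 <= tau -> (forall v, v \in V -> 0 <= w v) ->
    y = tau *: p + realize V u w -> tau + \sum_(v <- V) w v = 1 /\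
    E (tau, fun v => if v \in V then w v else 0).
  move=> t0 w0 yE.
  have sw : tau + \sum_(v <- V) w v = 1.
    have := congr1 (dot c0) yE; rewrite dotDr dotZr !height a_sum mulr1 b1.
    by move=> <-.
  have sw0 : 0 <= \sum_(v <- V) w v by rewrite big_seq; exact: sumr_ge0.
  split=> //; split=> /=; last first.
    apply/eqP; rewrite subr_eq0 {1}yE; apply/eqP; congr (_ + _).
    by rewrite /realize big_seq [RHS]big_seq; apply: eq_bigr => v ->.
  split=> [|v]; rewrite in_itv /=; first by apply/andP; split; lra.
  case: ifP => [vV|_]; last by rewrite lexx ler01.
  rewrite w0 //=; apply: (@le_trans _ _ (\sum_(v <- V) w v)); last by lra.
  rewrite (big_fsetD1 v) //= lerDl big_seq; apply: sumr_ge0 => x.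
  by rewrite !inE => /andP[_ /w0].
have E0 : E !=set0.
  have [|||_ Eb] := wE 0 b; [by []|by move=> v _|by rewrite scale0r add0r|].
  by eexists; exact: Eb.
have cfst : {within E, continuous fst} by apply: continuous_subspaceT => tw; exact: cvg_fst.
have [[tau w] + tmax] := compact_EVT_max E0 clE cfst.
rewrite inE => -[/= [t01 w01] /eqP]; rewrite subr_eq0 => /eqP yE.
have w0 v : 0 <= w v by have := w01 v; rewrite in_itv /= => /andP[].
have [t0 t1] : 0 <= tau /\ tau <= 1 by move: t01; rewrite in_itv /= => /andP[].
have [tw _] := wE _ _ t0 (fun v _ => w0 v) yE.
set z := realize V u w in yE.
(* Generators for Farkas' lemma, with [- z] under the index [None]. If [- p] has coefficient l at
   [- z], then l z is p plus nonnegative weights; heights force l > 0, so p / l splits off z and tau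
   could grow. *)
pose u' (o : option K) := if o is Some v then u v else - z.
have u'E (W : option K -> R) : \sum_(o <- None :: [seq Some v | v <- V]) W o *: u' o =
    \sum_(v <- V) W (Some v) *: u v - W None *: z.
  by rewrite big_cons big_map /= scalerN addrC.
have [H|] := pselect (forall c, (forall o, o \in None :: [seq Some v | v <- V] -> 0 <= dot c (u' o)) ->
    0 <= dot c (- p)).
  have [|W W0] := farkas _ H.
    rewrite /= map_inj_uniq ?fset_uniq ?andbT; last by move=> x x' [].
    by apply/negP => /mapP[].
  rewrite u'E; set l := W None => /eqP; rewrite eq_sym subr_eq => /eqP WE.
  have l0 : 0 <= l by exact: W0.
  pose w1 : {ptws K -> R} := fun v => W (Some v).
  have w1s0 : 0 <= \sum_(v <- V) w1 v by apply: sumr_ge0 => v _; exact: W0.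
  have := congr1 (dot c0) WE; rewrite [X in dot c0 X = _](_ : _ = realize V u w1) //.
  rewrite dotDr dotNr dotZr !height a_sum => h.
  have lt : 1 <= l * (1 - tau).
    rewrite (_ : 1 - tau = \sum_(v <- V) w v); last by lra.
    by move: h w1s0; lra.
  have lpos : 0 < l by rewrite lt_neqAle l0 andbT; apply: contraTneq lt => <-; rewrite mul0r ler10.
  have zE : z = l^-1 *: p + realize V u (fun v => l^-1 * w1 v).
    apply: (@scalerI _ _ l); first by rewrite gt_eqF.
    rewrite scalerDr scalerA divff ?gt_eqF // scale1r /realize.
    under eq_bigr do rewrite -scalerA.
    rewrite -scaler_sumr scalerA divff ?gt_eqF // scale1r.
    by rewrite [X in _ + X]WE addrA addrN add0r.
  have [|||_ Eb] := wE (tau + l^-1) (fun v => l^-1 * w1 v).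
  - by rewrite addr_ge0 // invr_ge0.
  - by move=> v _; rewrite mulr_ge0 ?invr_ge0 //; exact: W0.
  - by rewrite yE zE scalerDl addrA.
  have := tmax _ (mem_set Eb); rewrite /= gerDl leNgt invr_gt0 lpos //.
move=> /existsNP[c /not_implyP[cu /negP]]; rewrite -ltNge dotNr oppr_lt0 => cp.
have cV v : v \in V -> 0 <= dot c (u v).
  by move=> vV; apply: (cu (Some v)); rewrite in_cons /=; apply: map_f.
have cz : dot c z = 0.
  apply/eqP; rewrite eq_le -oppr_ge0 -dotNr (cu None) ?mem_head //=.
  by rewrite dot_realize big_seq; apply: sumr_ge0 => v vV; rewrite mulr_ge0 ?cV.
pose F := [fset v in V | dot c (u v) == 0]%fset.
have SF : S F.
  apply: (real_face rS) => //; apply: contrapT => H; move: cp; rewrite dot_realize.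
  rewrite big_seq big1 ?ltxx // => v vV; apply/eqP; rewrite mulf_eq0; apply/orP; right.
  by rewrite eq_le cV // andbT leNgt; apply/negP => cv; apply: H; exists v.
have wF v : v \in V -> v \notin F -> w v = 0.
  move=> vV; rewrite !inE vV /= => cv; move: cz; rewrite dot_realize => /eqP.
  rewrite big_seq psumr_eq0 => [/allP/(_ v vV)|x xV]; last by rewrite mulr_ge0 ?cV.
  by rewrite vV mulf_eq0 (negbTE cv) orbF => /eqP.
have tneq1 : 1 - tau != 0.
  apply: contraNneq yp => t1'; rewrite yE.
  have -> : tau = 1 by lra.
  rewrite scale1r -[X in _ == X]addr0; apply/eqP; congr (_ + _).
  have : \sum_(v <- V) w v == 0 by apply/eqP; lra.
  rewrite psumr_eq0 // => /allP wz; rewrite /z /realize big_seq big1 // => v vV.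
  by have /= /eqP -> := wz v vV; rewrite scale0r.
have tpos : 0 < 1 - tau by rewrite lt_neqAle eq_sym tneq1; lra.
pose w2 : {ptws K -> R} := fun v => if v \in F then w v / (1 - tau) else 0.
have FV : (F `<=` V)%fset by exact: fset_sub.
have w2E v : v \in V -> w2 v = (1 - tau)^-1 * w v.
  move=> vV; rewrite /w2; case: ifP => [_|/negbT vF]; first by rewrite mulrC.
  by rewrite (wF v vV vF) mulr0.
have w2F v : v \notin F -> w2 v = 0 by rewrite /w2 => /negbTE ->.
exists w2, (1 - tau); split.
- exists F; split=> // [v|]; first by rewrite /w2; case: ifP => // _; rewrite divr_ge0 // ltW.
  rewrite -(sum_supported FV w2F) big_seq (eq_bigr _ w2E) -big_seq -mulr_sumr.
  have -> : \sum_(v <- V) w v = 1 - tau by lra.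
  by rewrite mulVf.
- by apply/andP; split; lra.
rewrite yE opprB addrCA subrr addr0; congr (_ + _).
rewrite /realize scaler_sumr /z /realize big_seq [RHS]big_seq; apply: eq_bigr => v vV.
by rewrite w2E // scalerA mulrA divff // mul1r.
Qed.

Theorem interior_point_covered d (B : set {fset K}) :
  homeomorphic (@carrier R K B) (@euclidean_ball R d.+1) ->
  homeomorphic (@carrier R K S) (@euclidean_sphere R d) ->
  S `<=` B -> (forall A, B A -> (A `<=` V)%fset) ->
  exists2 b, @carrier R K B b & realize V u b = p.
Proof.
move=> hB hS SB BV; apply: contrapT => H.
have yp b : @carrier R K B b -> realize V u b != p.
  by move=> Bb; apply/eqP => bp; apply: H; exists b.
(* A zero (w, t) of [G (b, _)] gives the exit point w of the ray from p through the image of b, and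
   the position t of that image on the segment from p to w. With t as a further unknown, the
   solutions range over a compact set. *)
pose G (z : {ptws K -> R} * ({ptws K -> R} * R)) : 'rV[R]_m :=
  realize V u z.1 - ((1 - z.2.2) *: p + z.2.2 *: realize V u z.2.1).
have cG : continuous G.
  have c2 : continuous (fun z : {ptws K -> R} * ({ptws K -> R} * R) => z.2.2).
    by move=> z; apply: (@continuous_comp _ _ _ snd snd); exact: cvg_snd.
  apply: continuous_rowB.
    move=> z; apply: (@continuous_comp _ _ _ fst (realize V u)); first exact: cvg_fst.
    exact: realize_continuous.
  apply: continuous_rowD.
    by apply: continuous_rowZ; [exact: continuous_1B|exact: continuous_rowC].
  apply: continuous_rowZ => // z.
  apply: (@continuous_comp _ _ _ (fst \o snd) (realize V u)).
    by apply: (@continuous_comp _ _ _ snd fst); [exact: cvg_snd|exact: cvg_fst].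
  exact: realize_continuous.
pose C := @carrier R K S `*` (`[0, 1]%classic : set R).
have cC : compact C by apply: compact_setX; [exact: carrier_compact hS|exact: segment_compact].
have /choice[g gP] : forall b, exists wt, @carrier R K B b -> C wt /\ G (b, wt) = 0.
  move=> b; have [Bb|nBb] := pselect (@carrier R K B b); last by exists (b, 0) => /nBb.
  have [A [BA b0 bA b1]] := Bb.
  have bV : \sum_(v <- V) b v = 1 by rewrite (sum_supported (BV _ BA) bA).
  have [w [t [Sw t01 E]]] := ray_exists b0 bV (yp _ Bb).
  exists (w, t) => _; split; first by split; rewrite //= in_itv.
  by apply/eqP; rewrite subr_eq0; apply/eqP.
have gU b wt : @carrier R K B b -> C wt -> G (b, wt) = 0 -> wt = g b.
  case: wt => w t Bb [/= Sw]; rewrite in_itv /= => /andP[t0 _] /eqP.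
  have [] := gP b Bb; case: (g b) => w' t' [/= Sw']; rewrite in_itv /= => /andP[t0' _] /eqP.
  rewrite /G /= !subr_eq0 => /eqP E' /eqP E.
  have [||-> -> //] := ray_unique Sw Sw' t0 t0'; first by rewrite -E.
  by rewrite -E; exact: yp.
have cg := compact_graph_continuous cC cG gP gU.
apply: (@ball_sphere_no_retraction R _ _ _ d (fst \o g) hB hS).
- exact: carrier_sub.
- apply: (@within_continuous_comp_on _ _ _ _ setT _ fst cg) => //.
  by apply: continuous_subspaceT => x; exact: cvg_fst.
- by move=> b /gP[[]].
move=> w Sw; have Bw := carrier_sub SB Sw.
(* A point of the carrier of S is its own exit point, with t = 1. *)
rewrite /= -(gU w (w, 1)) //; first by split; rewrite //= in_itv /= ler01 lexx.
by rewrite /G /= subrr scale0r add0r scale1r subrr.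
Qed.

End Covering.

(** * Stacked balls *)

Lemma stacked_ball_clique (R : realType) (K : choiceType) (k d : nat) (S B : set {fset K}) :
  (2 * k <= d)%N -> triangulated_sphere R d S -> polytopal R S ->
  stacked_ball R k d B -> S = ball_boundary d B -> B = clique_extension k S.
Proof.
move=> kd [cS hS] pS [_ [[_ B0 Bsub] hB] stB] SE.
have SB : S `<=` B by rewrite SE => A [F [BF _ _ AF]]; exact: Bsub BF AF.
have SF A : S A -> exists F, [/\ S F, #|` F| = d.+1 & (A `<=` F)%fset].
  rewrite SE => -[F [BF Fd GF AF]]; exists F; split=> //.
  by exists F; split=> //; exact: fsubset_refl.
have small A : B A -> (#|` A| + k <= d.+1)%N -> S A by rewrite SE; exact: stB.
have BV x A : B A -> x \in A -> S [fset x]%fset.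
  move=> BA xA; apply: small; last by rewrite cardfs1; lia.
  by apply: (Bsub _ _ BA); rewrite fsub1set.
have [F0 [SF0 F0d _]] : exists F, [/\ S F, #|` F| = d.+1 & (fset0 `<=` F)%fset].
  by apply: SF; case: cS.
have Snonempty : exists2 A, S A & A != fset0 by exists F0; rewrite // -cardfs_eq0 F0d.
have [m [V [u [c0 rS]]]] := polytopal_realization cS Snonempty pS.
have inV x : S [fset x]%fset -> x \in V.
  by move=> /(real_vertices rS) /fsubsetP; apply; exact: fset11.
apply/seteqP; split=> A.
  move=> BA; split=> [x|C CA Ck]; first exact: BV.
  by apply: small; [exact: Bsub BA CA|lia].
move=> [Avert Aclique]; apply: contrapT => nBA.
have nSA : ~ S A by move/SB.
have An0 : #|` A|%:R != 0 :> R.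
  by rewrite pnatr_eq0 cardfs_eq0; apply: contra_notN nBA => /eqP ->.
have AV : (A `<=` V)%fset by apply/fsubsetP => x /Avert /inV.
pose a v : R := if v \in A then #|` A|%:R^-1 else 0.
have a0 v : 0 <= a v by rewrite /a; case: ifP => // _; rewrite invr_ge0 ler0n.
have a1 : \sum_(v <- V) a v = 1.
  rewrite (sum_supported AV) => [|v /negbTE vA]; last by rewrite /a vA.
  rewrite big_seq (eq_bigr (fun=> #|` A|%:R^-1)) => [|v vA]; last by rewrite /a vA.
  by rewrite -big_seq big_const_seq count_predT iter_addr_0 -[LHS]mulr_natr mulVf.
(* Since A is not a face of S, its barycentre lies on no proper face of the polytope. *)
have aint X : S X -> exists2 v, v \in V & (0 < a v) && (v \notin X).
  move=> SX; have /fsubsetPn[v vA vX] : ~~ (A `<=` X)%fset.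
    by apply/negP => AX; apply: nSA; case: cS => _ _; apply; [exact: SX|exact: AX].
  exists v; first exact: (fsubsetP AV).
  by rewrite vX andbT /a vA invr_gt0 lt_neqAle eq_sym An0 ler0n.
have BVs X : B X -> (X `<=` V)%fset by move=> BX; apply/fsubsetP => x /(BV _ _ BX) /inV.
have [b [F [BF b0 bF _]] bE] := interior_point_covered rS a0 a1 aint hB hS SB BVs.
(* If the barycentre of A and its preimage have equal weights, A is contained in F and so belongs to
   B. *)
have [[v vV wv]|weq] := pselect (exists2 v, v \in V & a v - b v != 0); last first.
  apply: nBA; apply: (Bsub _ _ BF); apply/fsubsetP => v vA; apply: contraT => vF.
  exfalso; apply: weq; exists v; first exact: (fsubsetP AV).
  by rewrite (bF _ vF) subr0 /a vA invr_eq0.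
have dep : \sum_(v <- V) (a v - b v) *: u v = 0.
  under eq_bigr do rewrite scalerBl.
  by rewrite sumrB; apply/eqP; rewrite subr_eq0; apply/eqP; exact: esym bE.
have facet : exists2 A, S A & #|` A| = d.+1 by exists F0.
have facet_max X : S X -> (#|` X| <= d.+1)%N.
  by move=> /SF[G [_ <- XG]]; exact: fsubset_leq_card.
have [P [N [[nSP nSN] PV NV PN]]] :=
  dependency_sides (w := fun v => a v - b v) rS facet facet_max (ex_intro2 _ _ v vV wv) dep.
have Pk : (k.+1 < #|` P|)%N.
  rewrite ltnNge; apply/negP => Pk; apply: nSP; apply: Aclique => //.
  apply/fsubsetP => x /PV[_]; rewrite subr_gt0 /a; case: ifP => // _.
  by rewrite ltNge b0.
(* As a subset of F, N is a face of B, so stackedness would put it in S if its size were at most d +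
   1 - k. *)
have Nk : (d.+1 < #|` N| + k)%N.
  rewrite ltnNge; apply/negP => Nk; apply: nSN; apply: small => //.
  apply: (Bsub _ _ BF); apply/fsubsetP => x /NV[_]; rewrite subr_lt0 => ab.
  by apply: contraT => xF; move: ab; rewrite (bF _ xF) ltNge a0.
lia.
Qed.

Theorem corollary3p6 (R : realType) (K : choiceType) (k d : nat)
    (S : set {fset K}) :
  (2 * k <= d)%N ->
  stacked_sphere R k d S ->
  polytopal R S ->
  exists Sbar : set {fset K},
    unique (fun B => stacked_ball R k d B /\ S = ball_boundary d B) Sbar /\
    Sbar = clique_extension k S.
Proof.
move=> kd [sphS [B [stB SE]]] pS.
(* Every k-stacked ball bounded by S is this same explicit complex, which yields uniqueness and the
   formula at once. *)
have clique B' := @stacked_ball_clique R K k d S B' kd sphS pS.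
exists B; split; last exact: clique.
by split=> // B' [stB' SE']; rewrite (clique _ stB SE) (clique _ stB' SE').
Qed.
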